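(* For every positive integer $\ell$, every $8\ell$-connected graph is $\ell$-knitted.
   Context: Graphs are finite and simple. For a graph $G$ and $S\subseteq V(G)$, the pair $(G,S)$ is knitted if for every partition of $S$ into non-empty subsets $S_1,\ldots,S_t$, there exist pairwise (vertex-)disjoint connected subgraphs $C_1,\ldots,C_t$ of $G$ such that $S_i\subseteq V(C_i)$ for all $1\le i\le t$. A graph $G$ is $\ell$-knitted if $(G,S)$ is knitted for every $S\subseteq V(G)$ with $|S|=\ell$. A graph is $m$-connected if it has more than $m$ vertices and remains connected after the deletion of any set of fewer than $m$ vertices. *)

(* Defs.v *)
From mathcomp Require Import all_boot.

Set Implicit Arguments.
Unset Strict Implicit.
Unset Printing Implicit Defensive.

Record sgraph := SGraph {
  vertex :> finType;
  adj : rel vertex;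
  adj_sym : symmetric adj;
  adj_irr : irreflexive adj
}.
Arguments adj {s} : rename.

(* With [sadj_sym], [sadj_in] puts both ends of every edge in [svert]. *)
Record subgraph (G : sgraph) := Subgraph {
  svert : {set G};
  sadj : rel G;
  sadj_sym : symmetric sadj;
  sadj_sub : subrel sadj adj;
  sadj_in : forall x y : G, sadj x y -> x \in svert
}.
Arguments svert {G} s : rename.
Arguments sadj {G} s : rename.

(* The graph with no vertices is not connected. *)
Definition connected (G : sgraph) (H : subgraph G) : Prop :=
  svert H != set0 /\ {in svert H &, forall x y : G, connect (sadj H) x y}.

Section Induced.
Variables (G : sgraph) (A : {set G}).

Definition induced_adj : rel G := [rel x y | [&& x \in A, y \in A & adj x y]].

Fact induced_adj_sym : symmetric induced_adj.
Proof. by move=> x y; rewrite /induced_adj /= adj_sym andbCA. Qed.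

Fact induced_adj_sub : subrel induced_adj adj.
Proof. by move=> x y /and3P[]. Qed.

Fact induced_adj_in (x y : G) : induced_adj x y -> x \in A.
Proof. by case/and3P. Qed.

Definition induced : subgraph G :=
  Subgraph induced_adj_sym induced_adj_sub induced_adj_in.
End Induced.

Definition k_connected (m : nat) (G : sgraph) : Prop :=
  m < #|G| /\ forall X : {set G}, #|X| < m -> connected (induced (~: X)).

(* The parts S_1, ..., S_t are pairwise distinct, so the subgraphs C_1, ..., C_t
   are indexed by the parts themselves; [partition] excludes empty parts. *)
Definition knitted (G : sgraph) (S : {set G}) : Prop :=
  forall P : {set {set G}}, partition P S ->
  exists C : {set G} -> subgraph G,
    [/\ {in P, forall B : {set G}, connected (C B)},
        {in P, forall B : {set G}, B \subset svert (C B)} &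
        {in P &, forall B1 B2 : {set G}, B1 != B2 ->
           [disjoint svert (C B1) & svert (C B2)]}].

Definition l_knitted (l : nat) (G : sgraph) : Prop :=
  forall S : {set G}, #|S| = l -> knitted S.

(* Main.v *)
Require Import Defs.
From mathcomp Require Import all_boot zify.

Set Implicit Arguments.
Unset Strict Implicit.
Unset Printing Implicit Defensive.

(** The argument follows Thomas and Wollan's proof of the linear edge bound for
    linkages.  A pair (G, X) is massed when more than 4l |V - X| edges meet V - X
    while no separation of order below |X| cuts off a side that is equally
    dense; an 8l-connected graph is massed for every l-set X.  In a minimal massed
    counterexample no small separation is rigid (its far side could be replaced
    by a clique on the cut), so every edge lies in at least 4l triangles (contract
    it otherwise), and the closed neighbourhood H of a vertex of low degree has at
    most 8l + 1 vertices and minimum degree at least 4l + 1, up to the terminals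
    in H.

    Menger's theorem then links X to any target large enough, and it remains to knit
    inside H.  Merge the terminals of H into connected clusters as cheaply as
    possible.  If the process is stuck, the vertices outside the clusters split
    into two parts without edges between them, and in the smaller part A the
    degrees are so large compared to |A| that the same merging process never gets
    stuck in A; then A is the target. *)

(** * Connected sets and separations *)

(** Massedness survives edge deletion, contraction and cutting along a separation unless the density
    is lost or a dense far side appears behind a cut smaller than [X]. Such a far side, taken with
    least order, is itself massed over its cut, so induction knits it and the cut is rigid. Undoing
    a deletion or contraction may enlarge the cut by one vertex, so cuts of order exactly [#|X|]
    matter as well; there the far side serves as a Menger target.

    Edges inside [X] are not counted, so vertices of [X] have no degree bound, and a terminal in H
    is controlled only because it remains a terminal of the linked set.

    The constants: 3 extra vertices per terminal keep the clusters in H within 4l vertices, one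
    below the minimum degree 4l + 1, so every terminal still sees a vertex outside them. In A, 3/4
    of a vertex per terminal suffices, and two nonadjacent terminals have a common neighbour outside
    the clusters. Both estimates hold with only an additive constant to spare. *)

Section Connected.
Variable T : finType.
Implicit Types (e : rel T) (D K V A B : {set T}) (x y : T).

Definition restr V e : rel T := fun x y => [&& x \in V, y \in V & e x y].
Arguments restr V e x y /.

Definition conn e D :=
  (D != set0) && [forall x in D, forall y in D, connect (restr D e) x y].

Lemma connP e D :
  reflect (D != set0 /\ {in D &, forall x y, connect (restr D e) x y}) (conn e D).
Proof.
apply: (iffP andP) => -[D0 H]; split=> //.
  by move=> x y xD yD; move/forall_inP: H => /(_ _ xD)/forall_inP; apply.
by apply/forall_inP=> x xD; apply/forall_inP=> y yD; apply: H.
Qed.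

Lemma restr_sym V e : symmetric e -> symmetric (restr V e).
Proof. by move=> es x y; rewrite /restr /= (es x y) andbCA. Qed.

Lemma connect_restr_sym V e : symmetric e -> connect_sym (restr V e).
Proof. by move=> es; apply: sym_connect_sym; apply: restr_sym. Qed.

Lemma connect_restrS V1 V2 e : V1 \subset V2 ->
  subrel (connect (restr V1 e)) (connect (restr V2 e)).
Proof.
move=> sV; apply: connect_sub => x y /= /and3P[x1 y1 exy]; apply: connect1.
by rewrite /= exy !(subsetP sV).
Qed.

Lemma conn1 e x : conn e [set x].
Proof.
apply/connP; split; first by apply/set0Pn; exists x; rewrite inE.
by move=> y z /set1P-> /set1P->.
Qed.

Lemma conn_from e D x : symmetric e -> x \in D ->
  (forall y, y \in D -> connect (restr D e) x y) -> conn e D.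
Proof.
move=> es xD H; apply/connP; split; first by apply/set0Pn; exists x.
move=> y z yD zD; apply: connect_trans (H _ zD).
by rewrite connect_restr_sym // H.
Qed.

Lemma connU e D1 D2 x y : symmetric e -> conn e D1 -> conn e D2 ->
  x \in D1 -> y \in D2 -> (x == y) || e x y -> conn e (D1 :|: D2).
Proof.
move=> es /connP[_ c1] /connP[_ c2] x1 y2 exy.
apply: (conn_from es (x := x)); first by rewrite inE x1.
move=> z; rewrite inE => /orP[z1|z2].
  by apply: connect_restrS (c1 _ _ x1 z1); apply: subsetUl.
apply: (@connect_trans _ _ y); last first.
  by apply: connect_restrS (c2 _ _ y2 z2); apply: subsetUr.
case/orP: exy => [/eqP->//|exy]; apply: connect1.
by rewrite /= !inE x1 y2 orbT.
Qed.

Lemma conn_adj1 e D x y : symmetric e -> conn e D -> y \in D -> e x y ->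
  conn e (x |: D).
Proof.
move=> es cD yD exy; apply: (connU es (conn1 e x) cD (set11 x) yD).
by rewrite exy orbT.
Qed.

Lemma conn_cut e D K x0 y0 : conn e D -> K \subset D -> x0 \in K ->
  y0 \in D :\: K -> exists x y, [/\ x \in K, y \in D :\: K & e x y].
Proof.
move=> /connP[_ cD] KD xK; rewrite inE => /andP[yK yD].
have /connectP[p] := cD _ _ (subsetP KD _ xK) yD.
elim: p x0 xK => [|z p IH] x xK /=; first by move=> _ yx; rewrite yx xK in yK.
case/andP=> /and3P[xD zD exz] pp lp; have [zK|zK] := boolP (z \in K).
  exact: IH zK pp lp.
by exists x, z; rewrite xK inE zK zD.
Qed.

Definition comp e V x := [set y | connect (restr V e) x y].

Lemma comp_refl e V x : x \in comp e V x.
Proof. by rewrite inE. Qed.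

Lemma comp_sub e V x : x \in V -> comp e V x \subset V.
Proof.
move=> xV; apply/subsetP=> y; rewrite inE => /connectP[p]; case: (lastP p) => [_ ->//|q w].
by rewrite rcons_path last_rcons => /andP[_ /and3P[_ w1 _]] ->.
Qed.

Lemma comp_closed e V x y z :
  y \in comp e V x -> y \in V -> z \in V -> e y z -> z \in comp e V x.
Proof.
rewrite !inE => xy yV zV eyz; apply: connect_trans xy (connect1 _).
by rewrite /= yV zV.
Qed.

Lemma comp_conn e V x : symmetric e -> x \in V -> conn e (comp e V x).
Proof.
move=> es xV; apply: (conn_from es (comp_refl e V x)) => y.
rewrite inE => /connectP[p pp ->] {y}.
suff H q y : path (restr V e) y q -> y \in comp e V x ->
    connect (restr (comp e V x) e) y (last y q) by apply: H pp (comp_refl _ _ _).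
elim: q y => [|z q IH] y //= /andP[/and3P[yV zV eyz] pq] yC.
have zC := comp_closed yC yV zV eyz.
by apply: connect_trans (IH _ pq zC); apply: connect1; rewrite /= yC zC.
Qed.

(** The component of [x] in [D :\: R] plus one vertex of [R] that it touches plays the role of a
    path stopped at its first vertex in [R]; connected sets replace paths throughout. *)
Lemma conn_meet_once e D R x : symmetric e -> conn e D -> x \in D ->
  D :&: R != set0 ->
  exists D' y, [/\ D' \subset D, conn e D', x \in D', D' :&: R = [set y] & y \in R].
Proof.
move=> es cD xD /set0Pn[z]; rewrite inE => /andP[zD zR].
have [xR|xR] := boolP (x \in R).
  exists [set x], x; split; rewrite ?sub1set ?inE //; first exact: conn1.
  by apply/setP=> y; rewrite !inE; case: eqP => // ->.
have xDR : x \in D :\: R by rewrite inE xR.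
pose K := comp e (D :\: R) x; have xK : x \in K := comp_refl _ _ _.
have KD : K \subset D :\: R by apply: comp_sub.
have zK : z \in D :\: K.
  by rewrite inE zD andbT; apply: contraL zR => /(subsetP KD); rewrite inE => /andP[].
have [u [y [uK yK euy]]] := conn_cut cD (subset_trans KD (subsetDl _ _)) xK zK.
have yD : y \in D by case/setDP: yK.
have yR : y \in R.
  apply: contraT => yR; case/setDP: yK => _ /negP[].
  by apply: comp_closed uK (subsetP KD _ uK) _ euy; rewrite inE yR.
exists (y |: K), y; split=> //.
- by rewrite subUset sub1set yD (subset_trans KD (subsetDl _ _)).
- by apply: (conn_adj1 es _ uK); rewrite ?(es y) //; apply: comp_conn.
- by rewrite inE xK orbT.
- apply/setP=> w; rewrite in_setI in_setU1 in_set1; case: eqP => [->|] //=.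
  move=> _; apply/negP=> /andP[wK wR].
  by move/(subsetP KD): wK; rewrite inE wR.
Qed.
End Connected.
Arguments restr {T} V e x y /.

Section Separations.
Variable T : finType.
Implicit Types (e : rel T) (D K V A B C X Y Z R : {set T}) (x y : T).

Definition sep V e A B :=
  (A :|: B == V) && [forall x in A :\: B, forall y in B :\: A, ~~ e x y].

Lemma sepP V e A B :
  reflect (A :|: B = V /\ (forall x y, x \in A -> x \notin B -> y \in B -> y \notin A -> ~~ e x y))
    (sep V e A B).
Proof.
apply: (iffP andP) => -[AB H]; split.
- exact/eqP.
- move=> x y xA xB yB yA; move/forall_inP: H => /(_ x); rewrite inE xA xB.
  by move=> /(_ isT)/forall_inP; apply; rewrite inE yB yA.
- exact/eqP.
apply/forall_inP=> x /setDP[xA xB]; apply/forall_inP=> y /setDP[yB yA].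
exact: H.
Qed.

Lemma sep_sub_l V e A B : sep V e A B -> A \subset V.
Proof. by case/sepP=> <- _; apply: subsetUl. Qed.
Lemma sep_sub_r V e A B : sep V e A B -> B \subset V.
Proof. by case/sepP=> <- _; apply: subsetUr. Qed.

Definition edges V e := [set p : T * T | [&& p.1 \in V, p.2 \in V & e p.1 p.2]].

Definition del e a b : rel T := fun x y => e x y && ([set x; y] != [set a; b]).
Arguments del e a b x y /.

Lemma del_sym e a b : symmetric e -> symmetric (del e a b).
Proof. by move=> es x y; rewrite /del /= es setUC. Qed.

Lemma del_edges V e a b : a \in V -> b \in V -> e a b ->
  #|edges V (del e a b)| < #|edges V e|.
Proof.
move=> aV bV eab; apply/proper_card/properP; split.
  by apply/subsetP=> p; rewrite !inE /= => /and3P[-> -> /andP[-> _]].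
by exists (a, b); rewrite !inE /= ?aV ?bV ?eab ?eqxx.
Qed.

Lemma edgesS V1 V2 e : V1 \subset V2 -> #|edges V1 e| <= #|edges V2 e|.
Proof.
move=> s; apply: subset_leq_card; apply/subsetP=> p; rewrite !inE.
by case/and3P=> /(subsetP s)-> /(subsetP s)-> ->.
Qed.

Lemma conn_sub_rel e e' D : subrel e e' -> conn e D -> conn e' D.
Proof.
move=> s /connP[D0 c]; apply/connP; split=> // x y xD yD.
apply: connect_sub (c _ _ xD yD) => u v /and3P[uD vD euv].
by apply: connect1; rewrite /= uD vD s.
Qed.

Lemma set2_mem (a b x y : T) : [set a; b] = [set x; y] ->
  (a = x /\ b = y) \/ (a = y /\ b = x).
Proof.
move=> E.
have : a \in [set x; y] by rewrite -E !inE eqxx.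
have : b \in [set x; y] by rewrite -E !inE eqxx orbT.
have : x \in [set a; b] by rewrite E !inE eqxx.
have : y \in [set a; b] by rewrite E !inE eqxx orbT.
by rewrite !inE => /orP[]/eqP? /orP[]/eqP? /orP[]/eqP? /orP[]/eqP?; subst; auto.
Qed.

Lemma trivIset_eq (F : {set {set T}}) D1 D2 x : trivIset F ->
  D1 \in F -> D2 \in F -> x \in D1 -> x \in D2 -> D1 = D2.
Proof.
by move=> tF F1 F2 x1 x2; rewrite -(def_pblock tF F1 x1) (def_pblock tF F2 x2).
Qed.

(* |F| disjoint sets all meeting a set Z of at most |F| elements meet it in
   exactly one element each, and exhaust it. *)
Lemma trivIset_transversal (F : {set {set T}}) Z : trivIset F ->
  (forall D, D \in F -> D :&: Z != set0) -> #|Z| <= #|F| ->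
  (forall z, z \in Z -> z \in cover F) /\
  (forall D y z, D \in F -> y \in D -> z \in D -> y \in Z -> z \in Z -> y = z).
Proof.
move=> tF mF cF.
have [->|/set0Pn[z0 _]] := eqVneq Z set0; first by split=> [z|D y z]; rewrite ?inE.
pose f D := odflt z0 [pick z in D :&: Z].
have fP D : D \in F -> f D \in D /\ f D \in Z.
  move=> DF; rewrite /f; case: pickP => [z|H]; first by rewrite inE => /andP[].
  by case/set0Pn: (mF _ DF) => z; rewrite H.
have dj D1 D2 z : D1 \in F -> D2 \in F -> z \in D1 -> z \in D2 -> D1 = D2.
  exact: trivIset_eq tF.
have finj : {in F &, injective f}.
  move=> D1 D2 F1 F2 E; apply: (dj _ _ (f D1) F1 F2); first by case: (fP _ F1).
  by rewrite E; case: (fP _ F2).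
have fZ : f @: F = Z.
  apply/eqP; rewrite eqEcard card_in_imset // cF andbT.
  by apply/subsetP=> z /imsetP[D DF ->]; case: (fP _ DF).
have H D z : D \in F -> z \in D -> z \in Z -> z = f D.
  move=> DF zD; rewrite -fZ => /imsetP[D' DF' E].
  suff <- : D' = D by [].
  by apply: (dj _ _ z) => //; rewrite E; case: (fP _ DF').
split=> [z|D y z DF yD zD yZ zZ]; last by rewrite (H D y) // (H D z).
rewrite -fZ => /imsetP[D DF ->]; apply/bigcupP; exists D => //.
by case: (fP _ DF).
Qed.
End Separations.
Arguments del {T} e a b x y /.

(** * Menger's theorem *)

Section Menger.
Variable T : finType.
Implicit Types (e : rel T) (D K V A B C X Y Z R : {set T}) (x y : T).

(* Goering's induction: if deleting the edge ab creates a separation (C1, C2) of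
   order below k, join linkages of C1 and C2 along C1 :&: C2 and ab. *)
Lemma menger_step e V A B C1 C2 a b k (e' := del e a b) : symmetric e ->
    a \in C1 -> a \notin C2 -> b \in C2 -> b \notin C1 -> e a b ->
    sep V e' C1 C2 -> A \subset C1 -> B \subset C2 -> #|C1 :&: C2| < k ->
    (forall D1 D2, sep V e D1 D2 -> A \subset D1 -> B \subset D2 ->
       k <= #|D1 :&: D2|) ->
    (forall V' A' B', V' \subset V -> A' \subset V' -> B' \subset V' ->
       (forall D1 D2, sep V' e' D1 D2 -> A' \subset D1 -> B' \subset D2 ->
          k <= #|D1 :&: D2|) ->
       exists F : {set {set T}}, [/\ trivIset F, k <= #|F| & forall D, D \in F ->
         [/\ D \subset V', conn e' D, D :&: A' != set0 & D :&: B' != set0]]) ->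
  exists F : {set {set T}}, [/\ trivIset F, k <= #|F| & forall D, D \in F ->
    [/\ D \subset V, conn e D, D :&: A != set0 & D :&: B != set0]].
Proof.
move=> es a1 a2 b2 b1 eab sC AC BC oC minsep IH.
have [UV nC] := sepP _ _ _ _ sC.
have C1V := sep_sub_l sC; have C2V := sep_sub_r sC.
have nC' p q : p \in C1 -> p \notin C2 -> q \in C2 -> q \notin C1 -> e p q ->
    p = a /\ q = b.
  move=> p1 p2 q2 q1 epq; move: (nC _ _ p1 p2 q2 q1); rewrite /e' /= epq negbK.
  move/eqP/set2_mem => [|[pb qa]] //; by rewrite pb (negPf b1) in p1.
have ne' p q : p <> a -> q <> a -> ~~ e' p q -> ~~ e p q.
  move=> pa qa; rewrite /e' /= negb_and => /orP[//|/negPn/eqP/set2_mem[[]|[]]//].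
have neb p q : p <> b -> q <> b -> ~~ e' p q -> ~~ e p q.
  move=> pa qa; rewrite /e' /= negb_and => /orP[//|/negPn/eqP/set2_mem[[]|[]]//].
pose S := C1 :&: C2.
have [F1 [tF1 cF1 pF1]] : exists F : {set {set T}}, [/\ trivIset F, k <= #|F| &
    forall D, D \in F -> [/\ D \subset C1, conn e' D, D :&: A != set0 &
      D :&: (a |: S) != set0]].
  apply: IH => //; first by rewrite subUset sub1set a1 subsetIl.
  move=> D1 D2 sD AD aSD; have [UD nD] := sepP _ _ _ _ sD.
  have D1C := sep_sub_l sD; have D2C := sep_sub_r sD.
  have aD : a \in D2 by apply: (subsetP aSD); rewrite !inE eqxx.
  have SD : S \subset D2 by apply: subset_trans aSD; apply: subsetUr.
  (* Adding [C2] to the far side leaves the order unchanged, since [D1] meets [C2] inside [S], hence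
     inside [D2]. The edge [ab] does not cross the new separation, as [a] lies in [D2]. *)
  have -> : D1 :&: D2 = D1 :&: (D2 :|: C2).
    apply/setP=> p; rewrite !inE; case p1: (p \in D1) => //=.
    case p2: (p \in C2); rewrite ?orbT ?orbF //.
    by rewrite (subsetP SD) // inE p2 (subsetP D1C).
  apply: minsep => //; last by rewrite (subset_trans BC) // subsetUr.
  apply/sepP; split; first by rewrite setUA UD.
  move=> p q p1; rewrite !inE negb_or => /andP[p2 pC2] q2 q1.
  have [qD2|qD2] := boolP (q \in D2).
    apply: neb; last exact: nD.
      by move=> pb; rewrite pb b2 in pC2.
    by move=> qb; move: (subsetP D2C _ qD2); rewrite qb (negPf b1).
  rewrite (negPf qD2) /= in q2.
  apply/negP=> epq; have [||pa _] := nC' p q _ pC2 q2 _ epq.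
  - exact: (subsetP D1C).
  - by apply: contra qD2 => q3; apply: (subsetP SD); rewrite inE q3.
  by rewrite pa aD in p2.
have [F2 [tF2 cF2 pF2]] : exists F : {set {set T}}, [/\ trivIset F, k <= #|F| &
    forall D, D \in F -> [/\ D \subset C2, conn e' D, D :&: (b |: S) != set0 &
      D :&: B != set0]].
  apply: IH => //; first by rewrite subUset sub1set b2 subsetIr.
  move=> D1 D2 sD bSD BD; have [UD nD] := sepP _ _ _ _ sD.
  have D1C := sep_sub_l sD; have D2C := sep_sub_r sD.
  have bD : b \in D1 by apply: (subsetP bSD); rewrite !inE eqxx.
  have SD : S \subset D1 by apply: subset_trans bSD; apply: subsetUr.
  have -> : D1 :&: D2 = (C1 :|: D1) :&: D2.
    apply/setP=> p; rewrite !inE; case p2: (p \in D2); rewrite ?andbF // !andbT.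
    case p1: (p \in C1) => //=.
    by rewrite (subsetP SD) // inE p1 (subsetP D2C).
  apply: minsep => //; last by rewrite (subset_trans AC) // subsetUl.
  apply/sepP; split; first by rewrite -setUA UD.
  move=> p q; rewrite !inE negb_or => p1 p2 q2 /andP[qC1 q1].
  have [pD1|pD1] := boolP (p \in D1).
    apply: ne'; last exact: nD.
      by move=> pa; move: (subsetP D1C _ pD1); rewrite pa (negPf a2).
    by move=> qa; rewrite qa a1 in qC1.
  rewrite (negPf pD1) orbF in p1.
  apply/negP=> epq; have [||_ qb] := nC' p q p1 _ _ qC1 epq.
  - by apply: contra pD1 => q3; apply: (subsetP SD); rewrite inE q3 p1.
  - exact: (subsetP D2C).
  by rewrite qb bD in q1.
(* Moving [a] to the other side turns [C1], [C2] into a separation for [e]. Hence [a |: S] has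
   exactly [k] elements, and each member of [F1] meets it once. *)
have cZ1 : k <= #|a |: S|.
  have -> : a |: S = C1 :&: (a |: C2).
    by apply/setP=> p; rewrite !inE; case: eqP => [->|] //=; rewrite a1.
  apply: minsep => //; last by rewrite (subset_trans BC) // subsetUr.
  apply/sepP; split.
    by rewrite setUCA UV; apply/setUidPr; rewrite sub1set (subsetP C1V).
  move=> p q p1; rewrite !inE negb_or => /andP[pa p2] /orP[/eqP->|q2] q1.
    by rewrite a1 in q1.
  by apply/negP=> epq; case: (nC' _ _ p1 p2 q2 q1 epq) => pa'; rewrite pa' eqxx in pa.
have cS x : #|x |: S| <= k by rewrite (leq_trans (leq_of_leqif (leq_card_setU _ _))) // cards1.
have [cov1 uni1] := trivIset_transversal tF1
  (fun D DF => let: And4 _ _ _ h := pF1 D DF in h) (leq_trans (cS a) cF1).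
have [cov2 uni2] := trivIset_transversal tF2
  (fun D DF => let: And4 _ _ h _ := pF2 D DF in h) (leq_trans (cS b) cF2).
(* Gluing rule: the two pieces at a vertex of [S] share that vertex, and the piece at [a] continues
   along the edge [ab]. *)
pose P z := pblock F1 z; pose sg z := if z == a then b else z; pose Q z := pblock F2 (sg z).
have aS : a \notin S by rewrite inE (negPf a2) andbF.
have bS : b \notin S by rewrite inE (negPf b1).
have sgZ z : z \in a |: S -> sg z \in b |: S.
  by rewrite /sg !inE; case: eqP => //= _; rewrite ?eqxx // => ->; rewrite orbT.
have PF z : z \in a |: S -> P z \in F1 /\ z \in P z.
  by move=> /cov1 zc; rewrite pblock_mem // mem_pblock.
have QF z : z \in a |: S -> Q z \in F2 /\ sg z \in Q z.
  by move=> /sgZ /cov2 zc; rewrite pblock_mem // mem_pblock.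
have PQ z z' w : z \in a |: S -> z' \in a |: S -> w \in P z -> w \in Q z' -> z = z'.
  move=> zZ zZ' wP wQ; have [PF1 zP] := PF _ zZ; have [QF2 zQ] := QF _ zZ'.
  have wS : w \in S.
    have [sP _ _ _] := pF1 _ PF1; have [sQ _ _ _] := pF2 _ QF2.
    by rewrite inE (subsetP sP) // (subsetP sQ).
  have wz : w = z by apply: (uni1 _ _ _ PF1 wP zP) => //; rewrite inE wS orbT.
  have : w = sg z' by apply: (uni2 _ _ _ QF2 wQ zQ) (sgZ _ zZ'); rewrite inE wS orbT.
  rewrite /sg; case: eqP => [_ wb|_ <-//]; by rewrite -wb wS in bS.
have PP z z' w : z \in a |: S -> z' \in a |: S -> w \in P z -> w \in P z' -> z = z'.
  move=> zZ zZ' wP wP'; have [PF1 zP] := PF _ zZ; have [PF2 zP'] := PF _ zZ'.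
  by apply: (uni1 _ _ _ PF1 zP) => //; rewrite (trivIset_eq tF1 PF1 PF2 wP wP').
have QQ z z' w : z \in a |: S -> z' \in a |: S -> w \in Q z -> w \in Q z' -> z = z'.
  move=> zZ zZ' wP wP'; have [PF1 zP] := QF _ zZ; have [PF2 zP'] := QF _ zZ'.
  have : sg z = sg z'.
    apply: (uni2 _ _ _ PF1 zP _ (sgZ _ zZ) (sgZ _ zZ')).
    by rewrite (trivIset_eq tF2 PF1 PF2 wP wP').
  move: zZ zZ'; rewrite /sg !inE.
  case: eqP => [->|_] /=; case: eqP => [->|_] //= z1 z2 E.
    by move: bS; rewrite E inE z2.
  by move: bS; rewrite -E inE z1.
pose h z := P z :|: Q z.
have hd z z' w : z \in a |: S -> z' \in a |: S -> w \in h z -> w \in h z' -> z = z'.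
  move=> zZ zZ'; rewrite !inE => /orP[] w1 /orP[] w2.
  - exact: PP w1 w2.
  - exact: PQ w1 w2.
  - by apply/esym; apply: PQ w2 w1.
  - exact: QQ w1 w2.
have zh z : z \in a |: S -> z \in h z by move=> /PF[_ zP]; rewrite inE zP.
exists (h @: (a |: S)); split.
- apply/trivIsetP=> _ _ /imsetP[z zZ ->] /imsetP[z' zZ' ->] ne.
  rewrite disjoint_subset; apply/subsetP=> w w1; rewrite inE; apply/negP=> w2.
  by rewrite (hd _ _ _ zZ zZ' w1 w2) eqxx in ne.
- rewrite card_in_imset // => z z' zZ zZ' E.
  by apply: (hd _ _ z) => //; rewrite -?E; apply: zh.
move=> _ /imsetP[z zZ ->].
have [PF1 zP] := PF _ zZ; have [QF2 zQ] := QF _ zZ.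
have [P1 P2 P3 P4] := pF1 _ PF1; have [Q1 Q2 Q3 Q4] := pF2 _ QF2.
have e'e : subrel e' e by move=> p q /andP[].
split.
- by rewrite subUset (subset_trans P1) // (subset_trans Q1).
- apply: (connU es (conn_sub_rel e'e P2) (conn_sub_rel e'e Q2) zP zQ).
  by rewrite /sg; case: (z =P a) => [->|_]; rewrite ?eab ?eqxx ?orbT.
- apply: contra_neq P3 => E; apply/eqP; rewrite -subset0 -E; apply: setSI; apply: subsetUl.
- apply: contra_neq Q4 => E; apply/eqP; rewrite -subset0 -E; apply: setSI; apply: subsetUr.
Qed.

(** Induction on the number of edges; [V], [A] and [B] vary because [menger_step] recurses into both
    sides. Loops are left alone: without other edges, [A :&: B] is itself a separator and its
    singletons are the family. *)
Lemma menger e V A B k : symmetric e -> A \subset V -> B \subset V ->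
    (forall C1 C2, sep V e C1 C2 -> A \subset C1 -> B \subset C2 ->
       k <= #|C1 :&: C2|) ->
  exists F : {set {set T}}, [/\ trivIset F, k <= #|F| & forall D, D \in F ->
    [/\ D \subset V, conn e D, D :&: A != set0 & D :&: B != set0]].
Proof.
have [n] := ubnP #|edges V e|; elim: n e V A B => // n IHn e V A B ne es AV BV minsep.
have [/exists_inP[[a b]] /=|noedge] := boolP [exists p in edges V e, p.1 != p.2]; last first.
  have kAB : k <= #|A :&: B|.
    have -> : A :&: B = A :&: (V :\: A :|: B).
      by apply/setP=> p; rewrite !inE; case: (p \in A).
    apply: minsep => //; last by rewrite subsetUr.
    apply/sepP; split=> [|p q pA _ qV qA].
      apply/setP=> p; move: (subsetP AV p) (subsetP BV p); rewrite !inE.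
      by case: (p \in A) => [->|_] //=; case: (p \in B) => [->|_]; rewrite ?orbT ?orbF.
    apply: contra noedge => epq; apply/exists_inP; exists (p, q) => /=.
      rewrite inE /= epq (subsetP AV) //=; move: qV; rewrite !inE.
      by case/orP=> [/andP[_ ->]|/(subsetP BV)->].
    by apply: contraNneq qA => <-.
  exists [set [set x] | x in A :&: B]; split.
  - apply/trivIsetP=> _ _ /imsetP[x _ ->] /imsetP[y _ ->] nxy.
    rewrite disjoints1 inE; by apply: contraNneq nxy => ->.
  - by rewrite card_imset //; apply: set1_inj.
  move=> _ /imsetP[x + ->]; rewrite inE => /andP[xA xB]; split.
  - by rewrite sub1set (subsetP AV).
  - exact: conn1.
  - by apply/set0Pn; exists x; rewrite !inE eqxx.
  - by apply/set0Pn; exists x; rewrite !inE eqxx.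
rewrite inE /= => /and3P[aV bV eab] nab.
have es' := del_sym a b es.
have ne' V' : V' \subset V -> #|edges V' (del e a b)| < n.
  move=> sV; have := edgesS (del e a b) sV; have := del_edges aV bV eab; lia.
have [/existsP[C1 /existsP[C2 /and4P[sC AC BC oC]]]|nosep] := boolP [exists C1, exists C2,
    [&& sep V (del e a b) C1 C2, A \subset C1, B \subset C2 & #|C1 :&: C2| < k]].
  have [UV nC] := sepP _ _ _ _ sC.
  have : ~~ sep V e C1 C2 by apply: contraL oC => s; rewrite -leqNgt; apply: minsep.
  rewrite /sep UV eqxx /= negb_forall_in => /exists_inP[x xC].
  rewrite negb_forall_in => /exists_inP[y yC] /negPn exy.
  case/setDP: xC => x1 x2; case/setDP: yC => y2 y1.
  (* The crossing edge is [ab] in one of its two orientations; renaming it spares a symmetric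
     case. *)
  have Exy : [set x; y] = [set a; b].
    by apply/eqP; move: (nC _ _ x1 x2 y2 y1); rewrite /= exy negbK.
  have Edel : del e a b = del e x y by rewrite /del Exy.
  rewrite Edel in sC es' ne'.
  apply: (menger_step es x1 x2 y2 y1 exy sC AC BC oC minsep).
  by move=> V' A' B' VV AV' BV'; apply: IHn => //; apply: ne'.
have [|F [tF cF pF]] := IHn (del e a b) V A B (ne' _ (subxx _)) es' AV BV.
  move=> C1 C2 sC AC BC; rewrite leqNgt; apply: contra nosep => oC.
  by apply/existsP; exists C1; apply/existsP; exists C2; rewrite sC AC BC.
exists F; split=> // D /pF[D1 D2 D3 D4]; split=> //.
by apply: conn_sub_rel D2 => p q /andP[].
Qed.

(** Each connected set is cut back to its first vertex in [R], so the linkage uses nothing of [R]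
    but its ends and the rest stays free for knitting. *)
Lemma linkage e V Z R : symmetric e -> Z \subset V -> R \subset V ->
    (forall C1 C2, sep V e C1 C2 -> Z \subset C1 -> R \subset C2 ->
       #|Z| <= #|C1 :&: C2|) ->
  exists (P : T -> {set T}) (f : T -> T),
    [/\ forall z, z \in Z -> [/\ P z \subset V, conn e (P z), z \in P z,
          P z :&: R = [set f z] & f z \in R] &
        forall z z' w, z \in Z -> z' \in Z -> w \in P z -> w \in P z' -> z = z'].
Proof.
move=> es ZV RV /(menger es ZV RV)[F [tF cF pF]].
have [cov uni] := trivIset_transversal tF
  (fun D DF => let: And4 _ _ h _ := pF D DF in h) cF.
have ex z : exists p : {set T} * T, z \in Z -> [/\ p.1 \subset pblock F z,
    conn e p.1, z \in p.1, p.1 :&: R = [set p.2] & p.2 \in R].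
  have [zZ|] := boolP (z \in Z); last by exists (set0, z).
  have zF := cov _ zZ; have DF := pblock_mem zF.
  have [D1 D2 D3 D4] := pF _ DF.
  have zP : z \in pblock F z by rewrite mem_pblock.
  have [D' [y H]] := conn_meet_once es D2 zP D4.
  by exists (D', y).
have [p hp] := fin_all_exists ex.
exists (fun z => (p z).1), (fun z => (p z).2); split=> [z zZ|z z' w zZ zZ' w1 w2].
  have [s1 s2 s3 s4 s5] := hp z zZ; split=> //; apply: subset_trans s1 _.
  by case: (pF _ (pblock_mem (cov _ zZ))).
have [s1 _ zp _ _] := hp z zZ; have [s1' _ zp' _ _] := hp z' zZ'.
have F1 := pblock_mem (cov _ zZ); have F2 := pblock_mem (cov _ zZ').
have E := trivIset_eq tF F1 F2 (subsetP s1 _ w1) (subsetP s1' _ w2).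
apply: (uni _ _ _ F1 (subsetP s1 _ zp)) => //; rewrite E; exact: (subsetP s1').
Qed.
End Menger.

(** * Knits as colourings, contraction and edge counts *)

Section Knitted.
Variable T : finType.
Implicit Types (e : rel T) (D K V A B C X Y Z R S : {set T}) (x y : T).

Definition mono V e (g : T -> T) : rel T :=
  fun x y => [&& x \in V, y \in V, e x y & g x == g y].

(* A knit is encoded by a colouring: the classes of S are the fibres of lab, and
   each one must lie in a monochromatic connected piece of a colouring g
   that extends lab. *)
Definition knit V e S (lab : T -> T) := exists g : T -> T,
  {in S, g =1 lab} /\
  (forall s t, s \in S -> t \in S -> lab s = lab t -> connect (mono V e g) s t).

Definition knittable V e S := forall lab : T -> T, knit V e S lab.

(** Labellings and colourings can be taken among finite functions, so this is a boolean test; it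
    permits arguing by contradiction from a minimal counterexample. *)
Lemma knittable_dec V e S : knittable V e S \/ ~ knittable V e S.
Proof.
pose b := [forall lab : {ffun T -> T}, exists g : {ffun T -> T},
  [forall s in S, (g s == lab s) &&
    [forall t in S, (lab s == lab t) ==> connect (mono V e g) s t]]].
have mE (g : T -> T) : mono V e [ffun x => g x] =2 mono V e g.
  by move=> x y; rewrite /mono !ffunE.
have [|nb] := boolP b; [move=> B; left=> lab|right=> k; case/negP: nb].
  have /existsP[g /forall_inP h] := forallP B [ffun x => lab x].
  exists g; split=> [s /h/andP[/eqP-> _]|s t sS tS st]; first by rewrite ffunE.
  have /andP[_ /forall_inP/(_ _ tS)] := h _ sS.
  by rewrite !ffunE st eqxx.
apply/forallP=> lab; have [g [gl gc]] := k lab.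
apply/existsP; exists [ffun x => g x]; apply/forall_inP=> s sS.
rewrite ffunE gl // eqxx /=; apply/forall_inP=> t tS; apply/implyP=> /eqP st.
by rewrite (eq_connect (mE g)); apply: gc.
Qed.

Lemma knittable_sub V e R S : S \subset R -> knittable V e R -> knittable V e S.
Proof.
move=> /subsetP SR kR lab; have [g [gl gc]] := kR lab.
by exists g; split=> [s /SR/gl|s t /SR sR /SR tR]; last exact: gc.
Qed.

Lemma knittable_mono V V' e e' S : V \subset V' -> subrel e e' -> knittable V e S -> knittable V' e' S.
Proof.
move=> /subsetP VV ee kV lab; have [g [gl gc]] := kV lab.
exists g; split=> // s t sS tS st; apply: connect_sub (gc _ _ sS tS st).
move=> x y /and4P[/VV xV /VV yV /ee exy gxy]; apply: connect1.
by rewrite /mono xV yV exy.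
Qed.

Lemma connect_mono_restr V e D g i : D \subset V -> {in D, forall x, g x = i} ->
  subrel (connect (restr D e)) (connect (mono V e g)).
Proof.
move=> /subsetP DV gD; apply: connect_sub => x y /and3P[xD yD exy].
by apply: connect1; rewrite /mono !DV // exy !gD /=.
Qed.

Definition clique Z e : rel T := fun x y => e x y || [&& x != y, x \in Z & y \in Z].

Lemma clique_sym Z e : symmetric e -> symmetric (clique Z e).
Proof. by move=> es x y; rewrite /clique (es x y) (eq_sym x y) (andbC (x \in Z)). Qed.

Lemma clique_irr Z e : irreflexive e -> irreflexive (clique Z e).
Proof. by move=> ei x; rewrite /clique ei eqxx. Qed.

(** A clique edge used by a knit in [A] joins two cut vertices of equal colour. Knitting the cut in
    [B], labelled by the colouring of [A], replaces it by a connection of that colour in [B]. *)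
Lemma knittable_clique A B e S : S \subset A -> knittable A (clique (A :&: B) e) S ->
  knittable B e (A :&: B) -> knittable (A :|: B) e S.
Proof.
move=> /subsetP SA kA kB lab; have [gA [Al Ac]] := kA lab; have [gB [Bl Bc]] := kB gA.
pose g x := if x \in A then gA x else gB x.
have gEB x : x \in B -> g x = gB x.
  by rewrite /g => xB; case: ifP => // xA; rewrite Bl // inE xA.
have gEA x : x \in A -> g x = gA x by rewrite /g => ->.
exists g; split=> [s sS|s t sS tS st]; first by rewrite gEA ?SA // Al.
apply: connect_sub (Ac _ _ sS tS st) => x y /and4P[xA yA /orP[exy|/and3P[_ xZ yZ]] /eqP gxy].
  by apply: connect1; rewrite /mono !inE xA yA exy !gEA // gxy /=.
apply: connect_sub (Bc _ _ xZ yZ gxy) => u w /and4P[uB wB euw /eqP guw].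
by apply: connect1; rewrite /mono !inE uB wB euw !gEB // guw /= !orbT eqxx.
Qed.

(** The label of [z] is carried to [f z]. Colouring all of [P z] by it cannot clash with the knit in
    [B], which [P z] meets only in [f z]. *)
Lemma knittable_link B1 B e Z (P : T -> {set T}) (f : T -> T) :
    (forall z, z \in Z -> [/\ P z \subset B1, conn e (P z), z \in P z &
       P z :&: B = [set f z]]) ->
    (forall z z' w, z \in Z -> z' \in Z -> w \in P z -> w \in P z' -> z = z') ->
  knittable B e (f @: Z) -> knittable (B1 :|: B) e Z.
Proof.
move=> HP dj kB lab.
have fP z : z \in Z -> f z \in P z /\ f z \in B.
  by move=> /HP[_ _ _ E]; apply/andP; rewrite -in_setI E set11.
have finj : {in Z &, injective f}.
  move=> z z' zZ zZ' E; apply: (dj _ _ (f z)) => //; first by case: (fP _ zZ).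
  by rewrite E; case: (fP _ zZ').
pose lab' y := if [pick z in Z | f z == y] is Some z then lab z else y.
have [gB [Bl Bc]] := kB lab'.
have lab'E z : z \in Z -> lab' (f z) = lab z.
  move=> zZ; rewrite /lab'; case: pickP => [z' /andP[zZ' /eqP/finj->//]|/(_ z)].
  by rewrite zZ eqxx.
pose g x := if x \in B then gB x else if [pick z in Z | x \in P z] is Some z then lab z else x.
have gP z : z \in Z -> {in P z, forall x, g x = lab z}.
  move=> zZ x xP; rewrite /g; case: ifP => [xB|_].
    have [_ _ _ E] := HP _ zZ; have : x \in P z :&: B by rewrite inE xP.
    by rewrite E => /set1P->; rewrite Bl ?imset_f // lab'E.
  case: pickP => [z' /andP[zZ' xP']|/(_ z)]; last by rewrite zZ xP.
  by rewrite (dj _ _ _ zZ zZ' xP xP').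
have cP z : z \in Z -> connect (mono (B1 :|: B) e g) z (f z) /\
    connect (mono (B1 :|: B) e g) (f z) z.
  move=> zZ; have [s1 /connP[_ c] zP E] := HP _ zZ; have [fz _] := fP _ zZ.
  have s2 := subset_trans s1 (subsetUl _ B).
  by split; apply: (connect_mono_restr s2 (gP _ zZ)); apply: c.
exists g; split=> [z zZ|s t sZ tZ st].
  by apply: gP => //; case: (HP _ zZ).
apply: connect_trans (cP _ sZ).1 _; apply: connect_trans _ (cP _ tZ).2.
have := Bc (f s) (f t); rewrite !imset_f // !lab'E // => /(_ isT isT st).
apply: connect_sub => x y /and4P[xB yB exy gxy]; apply: connect1.
by rewrite /mono !inE xB yB exy !orbT /g xB yB.
Qed.

(* Contraction of the edge uv; u names the new vertex and v is to be discarded. *)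
Definition contr u v e : rel T := fun x y =>
  [|| e x y, [&& x == u, e v y & y != u] | [&& y == u, e v x & x != u]].

Lemma contr_sym u v e : symmetric e -> symmetric (contr u v e).
Proof. by move=> es x y; rewrite /contr (es x y); congr (_ || _); rewrite orbC. Qed.

Lemma contr_irr u v e : irreflexive e -> irreflexive (contr u v e).
Proof. by move=> ei x; rewrite /contr ei /=; case: eqP; rewrite //= !andbF. Qed.

(** Give [v] the colour of [u]; an edge at [u] created by the contraction is then replaced by the
    path through [v]. *)
Lemma knittable_contr B u v e S : symmetric e -> u \in B -> v \notin B -> e u v ->
  S \subset B -> knittable B (contr u v e) S -> knittable (v |: B) e S.
Proof.
move=> es uB vB euv /subsetP SB kB lab; have [g' [gl gc]] := kB lab.
pose g x := if x == v then g' u else g' x.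
have gE x : x \in B -> g x = g' x.
  by rewrite /g; case: eqP => // ->; rewrite (negPf vB).
have gv : g v = g' u by rewrite /g eqxx.
have evu : e v u by rewrite es.
exists g; split=> [s sS|s t sS tS st]; first by rewrite gE ?SB // gl.
apply: connect_sub (gc _ _ sS tS st) => x y /and4P[xB yB + /eqP gxy].
case/or3P=> [exy|/and3P[/eqP E evy _]|/and3P[/eqP E evx _]].
- by apply: connect1; rewrite /mono !inE xB yB exy !gE // gxy eqxx !orbT.
- apply: (@connect_trans _ _ v); apply: connect1; rewrite /mono !inE eqxx ?xB ?yB ?orbT /=.
    by rewrite E euv gv gE // eqxx.
  by rewrite evy gv gE // -gxy E eqxx.
apply: (@connect_trans _ _ v); apply: connect1; rewrite /mono !inE eqxx ?xB ?yB ?orbT /=.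
  by rewrite es evx gv gE // gxy E eqxx.
by rewrite E evu gv gE // eqxx.
Qed.

Lemma sep_sym V e A B : symmetric e -> sep V e A B -> sep V e B A.
Proof.
move=> es /sepP[UV nC]; apply/sepP; split; first by rewrite setUC.
by move=> x y *; rewrite es; apply: nC.
Qed.

Lemma sep_subrel V e e' A B : subrel e e' -> sep V e' A B -> sep V e A B.
Proof.
move=> ee /sepP[UV nC]; apply/sepP; split=> // x y xA xB yB yA.
by apply/negP=> /ee; apply/negP; apply: nC.
Qed.

(** The old cut lies in [A1], so all of [A] can join that side without touching [B1 :\: A1]. *)
Lemma sep_lift V e A B A1 B1 : sep V e A B -> sep B e A1 B1 -> A :&: B \subset A1 ->
  [/\ sep V e (A :|: A1) B1, (A :|: A1) :&: B1 = A1 :&: B1 &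
      B1 :\: (A :|: A1) = B1 :\: A1].
Proof.
move=> sV sB /subsetP AB; have [UV nC] := sepP _ _ _ _ sV.
have [UB nD] := sepP _ _ _ _ sB.
have B1B := subsetP (sep_sub_r sB); have A1B := subsetP (sep_sub_l sB).
have h p : p \in B1 -> p \in A -> p \in A1.
  by move=> /B1B pB pA; apply: AB; rewrite inE pA.
split.
- apply/sepP; split; first by rewrite -setUA UB.
  move=> p q; rewrite !inE negb_or => p1 p2 q2 /andP[qA q1].
  have [pA1|pA1] := boolP (p \in A1); first exact: nD.
  rewrite (negPf pA1) orbF in p1; apply: nC => //; last exact: B1B.
  by apply: contra pA1 => pB; apply: AB; rewrite inE p1.
- apply/setP=> p; rewrite !inE; case p1: (p \in B1); rewrite ?andbF // !andbT.
  by case pA: (p \in A) => //=; rewrite h.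
- apply/setP=> p; rewrite !inE negb_or; case p1: (p \in B1); rewrite ?andbF // !andbT.
  by case pA: (p \in A) => //=; rewrite h.
Qed.

Lemma sep_lift_l V e A B A1 B1 : symmetric e -> sep V e A B -> sep A e A1 B1 ->
  A :&: B \subset B1 ->
  sep V e A1 (B1 :|: B) /\ A1 :&: (B1 :|: B) = A1 :&: B1.
Proof.
move=> es /(sep_sym es) s1 /(sep_sym es) s2 AB.
have [|h1 h2 _] := sep_lift s1 s2; first by rewrite setIC.
by split; [rewrite setUC; apply: sep_sym | rewrite setUC setIC h2 setIC].
Qed.

(* Ordered pairs: every edge with an end in Y is counted twice. *)
Definition pairs V e Y := [set p : T * T |
  [&& p.1 \in V, p.2 \in V, e p.1 p.2 & (p.1 \in Y) || (p.2 \in Y)]].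

Lemma pairs_eq V1 V2 e Y : symmetric e -> V2 \subset V1 -> Y \subset V2 ->
  (forall x y, x \in Y -> y \in V1 -> e x y -> y \in V2) -> pairs V1 e Y = pairs V2 e Y.
Proof.
move=> es /subsetP V21 /subsetP YV H; apply/setP=> -[x y]; rewrite !inE /=.
apply/and4P/and4P=> -[xV yV exy xyY]; split=> //; try exact: V21.
  case/orP: xyY => [/YV //|yY]; apply: (H y) => //; by rewrite es.
case/orP: xyY => [xY|/YV //]; exact: (H x).
Qed.

Lemma pairs_sep V e A B : symmetric e -> sep V e A B ->
  pairs V e (B :\: A) = pairs B e (B :\: A).
Proof.
move=> es s; have [UV nC] := sepP _ _ _ _ s.
apply: pairs_eq => //; [exact: sep_sub_r s|exact: subsetDl|].
move=> x y; rewrite inE => /andP[xA xB]; rewrite -UV inE => /orP[yA|//] exy.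
by apply: contraTT exy => yB; rewrite es; apply: nC.
Qed.
End Knitted.

(** * Massed pairs *)

Section Massed.
Variables (T : finType) (al l : nat).
Implicit Types (e : rel T) (D K V A B C X Y Z R S : {set T}) (x y : T).

Definition sparse_seps V e X := forall A B, sep V e A B -> X \subset A -> #|A :&: B| < #|X| ->
  #|pairs V e (B :\: A)| <= 2 * al * #|B :\: A|.

Definition massed V e X :=
  [/\ X \subset V, 2 * al * #|V :\: X| < #|pairs V e (V :\: X)| & sparse_seps V e X].

Definition IHmassed n := forall V e X, #|V| < n -> symmetric e -> irreflexive e ->
  #|X| <= l -> massed V e X -> knittable V e X.

Lemma massed_sub V e X A B : symmetric e -> sep V e A B -> X \subset A ->
  2 * al * #|B :\: A| < #|pairs V e (B :\: A)| ->
  (forall A' B', sep V e A' B' -> X \subset A' -> #|A' :&: B'| < #|A :&: B| ->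
     #|pairs V e (B' :\: A')| <= 2 * al * #|B' :\: A'|) ->
  massed B e (A :&: B).
Proof.
move=> es s XA viol H; have EB : B :\: (A :&: B) = B :\: A.
  by apply/setP=> p; rewrite !inE; case: (p \in B); rewrite ?andbF ?andbT.
split; first exact: subsetIr.
  by rewrite EB -(pairs_sep es s).
move=> A1 B1 s1 AB o1; have [s2 E1 E2] := sep_lift s s1 AB.
have := H _ _ s2; rewrite E1 E2 => /(_ (subset_trans XA (subsetUl _ _)) o1).
by rewrite (pairs_sep es s1); have := pairs_sep es s2; rewrite E2 => ->.
Qed.

(** Take a violating separation of least order. Every separation of smaller order is sparse, so
    [massed_sub] makes [B] massed over the cut; [B] is smaller than [V], so induction knits it. *)
Lemma sparse_or_rigid n V e X : IHmassed n -> #|V| <= n -> symmetric e -> irreflexive e ->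
    #|X| <= l ->
  sparse_seps V e X \/ exists A B, [/\ sep V e A B, X \subset A, #|A :&: B| < #|X|,
    2 * al * #|B :\: A| < #|pairs V e (B :\: A)| & knittable B e (A :&: B)].
Proof.
move=> IH Vn es ei Xl.
pose viol (p : {set T} * {set T}) := [&& sep V e p.1 p.2, X \subset p.1,
  #|p.1 :&: p.2| < #|X| &
  2 * al * #|p.2 :\: p.1| < #|pairs V e (p.2 :\: p.1)|].
case: (pickP viol) => [p0 v0|nv]; last first.
  left=> A B s XA o; rewrite leqNgt; apply/negP=> v.
  by have := nv (A, B); rewrite /viol /= s XA o v.
right; case: (arg_minnP (fun p : {set T} * {set T} => #|p.1 :&: p.2|) v0) => -[A B] /and4P[/= s XA o v] mn.
exists A, B; split=> //; apply: IH => //.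
- apply: leq_trans Vn; rewrite -(sepP _ _ _ _ s).1.
  have : #|A :&: B| < #|A| by apply: leq_trans o (subset_leq_card XA).
  by rewrite cardsU; have := subset_leq_card (subsetIl A B); lia.
- by apply: leq_trans (ltnW o) _.
apply: (massed_sub es s XA v) => A' B' s' XA' o'.
rewrite leqNgt; apply/negP=> v'; have := mn (A', B').
rewrite /viol /= s' XA' v' (ltn_trans o' o) => /(_ isT); lia.
Qed.

Lemma cardsD_sub X V : X \subset V -> #|V :\: X| + #|X| = #|V|.
Proof. by move=> /setIidPr XV; rewrite -[in RHS](cardsID X V) XV addnC. Qed.

Lemma order_proper X A B : X \subset A -> #|A :&: B| < #|X| -> A :\: B != set0.
Proof.
move=> XA o; rewrite -card_gt0; have := cardsID B A; have := subset_leq_card XA; lia.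
Qed.

Section Minimal.
Variables (V : {set T}) (e : rel T) (X : {set T}).
Hypotheses (es : symmetric e) (ei : irreflexive e) (Xl : #|X| <= l).
Hypotheses (ms : massed V e X) (IH : IHmassed #|V|).

(* Induction on |A|: either A with its cut made complete is massed, or it has a
   violating separation, which yields a rigid one with a smaller A. *)
Lemma rigid_knittable A B : sep V e A B -> X \subset A -> #|A :&: B| < #|X| ->
  B :\: A != set0 -> knittable B e (A :&: B) -> knittable V e X.
Proof.
have [XV M1 M2] := ms.
have [n] := ubnP #|A|; elim: n A B => // n IHn A B An s XA o BA0 kB.
set Z := A :&: B in o kB; pose e' := clique Z e.
have es' : symmetric e' by apply: clique_sym.
have ei' : irreflexive e' by apply: clique_irr.
have ee' : subrel e e' by move=> x y; rewrite /e' /clique => ->.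
have AV := sep_sub_l s; have [UV nC] := sepP _ _ _ _ s.
have cBA : 0 < #|B :\: A| by rewrite card_gt0.
have EV : V :\: A = B :\: A by rewrite -UV setDUl setDv set0U.
have cA : #|B :\: A| + #|A| = #|V| by rewrite -EV cardsD_sub.
have cX := cardsD_sub XA; have cXV := cardsD_sub XV.
(* Removing [B :\: A] costs at most [2 * al] pairs per vertex, by sparseness of the separation
   itself, so the density survives in [A]. *)
have M1' : 2 * al * #|A :\: X| < #|pairs A e' (A :\: X)|.
  have M2BA := M2 _ _ s XA o.
  have : #|pairs V e (V :\: X)| <= #|pairs A e' (A :\: X) :|: pairs V e (B :\: A)|.
    apply/subset_leq_card/subsetP=> -[x y]; rewrite !inE /= => /and4P[xV yV exy xyX].
    rewrite xV yV exy (ee' _ _ exy) /=; move: xV yV xyX; rewrite -!UV !inE.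
    by case: (x \in A); case: (y \in A) => /=; rewrite ?andbT ?andbF ?orbT ?orbF // => -> ->;
      rewrite ?orbT.
  have := leq_of_leqif (leq_card_setU (pairs A e' (A :\: X)) (pairs V e (B :\: A))).
  have EX : #|V :\: X| = #|A :\: X| + #|B :\: A| by lia.
  by move: M1; rewrite EX mulnDr; lia.
suff M2' : sparse_seps A e' X \/ knittable V e X.
  case: M2' => // M2'; rewrite -UV; apply: knittable_clique => //; apply: IH => //.
  by rewrite -cA; lia.
have [|M2'|] := @sparse_or_rigid #|V| A e' X IH _ es' ei' Xl; first by lia.
  by left.
case=> A2 [B2 [s2 XA2 o2 v2 k2]]; right.
have s2e : sep A e A2 B2 by apply: sep_subrel s2.
have A2A := sep_sub_l s2; have B2A := sep_sub_r s2.
have B20 : B2 :\: A2 != set0.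
  by apply: contraTneq v2 => ->; rewrite cards0 muln0 -leqNgt leqn0 cards_eq0;
   apply/eqP/setP=> p; rewrite !inE !andbF.
(* [Z] is a clique for [e'], hence lies on one side. If in [A2], the violation lifts to [V] and
   contradicts massedness; if in [B2], the union [B2 :|: B] is a rigid far side leaving the smaller
   near side [A2]. *)
have [ZA|/subsetPn[z zZ zA2]] := boolP (Z \subset A2).
  have sBA : sep V e B A by apply: sep_sym.
  have [|s3 E1 E2] := sep_lift sBA s2e; first by rewrite setIC.
  have := M2 _ _ s3 (subset_trans XA2 (subsetUr _ _)); rewrite E1 E2 => /(_ o2).
  rewrite -E2 (pairs_sep es s3) E2 leqNgt => /negP[].
  rewrite (pairs_sep es' s2) in v2; apply: leq_trans v2 _.
  apply/subset_leq_card/subsetP=> -[x y]; rewrite !inE /= => /and4P[-> -> + xyB].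
  case/orP=> [->|/and3P[_ /(subsetP ZA) xA /(subsetP ZA) yA]] //.
  by rewrite xA yA in xyB.
have ZB : Z \subset B2.
  have [U2 n2] := sepP _ _ _ _ s2; have ZA : Z \subset A by apply: subsetIl.
  apply/subsetP=> z' zZ'; apply: contraT => zB'.
  have zB : z \in B2.
    by have := subsetP ZA _ zZ; rewrite -U2 inE (negPf zA2).
  have zA' : z' \in A2.
    by have := subsetP ZA _ zZ'; rewrite -U2 inE (negPf zB') orbF.
  have := n2 _ _ zA' zB' zB zA2; rewrite /e' /clique zZ zZ' !andbT negb_or negbK.
  by case/andP=> _ /eqP E; rewrite E zB in zB'.
have [s3 E3] := sep_lift_l es s s2e ZB.
apply: (IHn A2 (B2 :|: B)) => //.
- rewrite ltnS in An; apply: leq_trans An; apply: proper_card; apply/properP; split=> //.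
  case/set0Pn: B20 => p /setDP[p1 p2]; exists p => //; exact: (subsetP B2A).
- by rewrite E3.
- by apply: contra_neq B20 => E; apply/eqP; rewrite -subset0 -E setSD // subsetUl.
have EZ : B2 :&: B = Z.
  apply/setP=> p; rewrite !inE; apply/andP/andP=> -[p1 p2]; split=> //.
    exact: (subsetP B2A).
  by apply: (subsetP ZB); rewrite inE p1.
by rewrite E3; apply: knittable_clique; rewrite ?EZ // subsetIr.
Qed.

(* A target R on the B-side of a separation, in which every linked subset of
   order at most |X| can be knitted: either Menger links X to R, or a minimum
   separator between X and R is rigid. *)
Lemma target_knittable A B : sep V e A B -> X \subset A -> #|X| <= #|A :&: B| ->
  (forall S, X :&: (A :&: B) \subset S -> S \subset A :&: B -> #|S| <= #|X| ->
     knittable B e S) -> knittable V e X.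
Proof.
move=> s XA oX kB; set R := A :&: B in oX kB.
have [UV nC] := sepP _ _ _ _ s.
have RA : R \subset A := subsetIl A B.
have RB : R \subset B := subsetIr A B.
(* Any minimum separator between [X] and [R] is linked to [R] inside [B1] and then knitted in [B].
   It is used for [X] itself and for a smaller separator. *)
have base A1 B1 : sep A e A1 B1 -> X \subset A1 -> R \subset B1 -> #|A1 :&: B1| <= #|X| ->
    (forall C1 C2, sep A e C1 C2 -> X \subset C1 -> R \subset C2 ->
       #|A1 :&: B1| <= #|C1 :&: C2|) -> knittable (B1 :|: B) e (A1 :&: B1).
  move=> s1 XA1 RB1 o1 mn; set Z := A1 :&: B1 in o1 mn *.
  have [|C1 C2 sC ZC RC|P [f [HP dj]]] := @linkage T e B1 Z R es _ RB1.
  - exact: subsetIr.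
  - by have [h1 h2 _] := sep_lift s1 sC ZC; rewrite -h2; apply: mn => //;
      apply: subset_trans XA1 (subsetUl _ _).
  have B1A := sep_sub_r s1.
  apply: (knittable_link (P := P) (f := f)) dj _ => [z zZ|].
    have [p1 p2 p3 p4 _] := HP _ zZ; split=> //; rewrite -p4.
    apply/setP=> w; rewrite !inE; case wP: (w \in P z) => //=.
    by rewrite (subsetP B1A) // (subsetP p1).
  apply: kB.
  (* A terminal already in [R] is its own end, since [P x] meets [R] only once. *)
  - apply/subsetP=> x; rewrite inE => /andP[xX xR].
    have xZ : x \in Z by rewrite inE (subsetP XA1) // (subsetP RB1).
    have [_ _ p3 p4 _] := HP _ xZ; have : x \in P x :&: R by rewrite inE p3.
    by rewrite p4 => /set1P->; apply: imset_f.
  - by apply/subsetP=> _ /imsetP[z zZ ->]; case: (HP _ zZ).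
  - exact: leq_trans (leq_imset_card _ _) o1.
have sXA : sep A e X A.
  apply/sepP; split; first by apply/setUidPr.
  by move=> x y xX; rewrite (subsetP XA).
pose Q (p : {set T} * {set T}) := [&& sep A e p.1 p.2, X \subset p.1 & R \subset p.2].
have Q0 : Q (X, A) by rewrite /Q /= sXA subxx.
case: (arg_minnP (fun p : {set T} * {set T} => #|p.1 :&: p.2|) Q0) => -[A1 B1] /and3P[/= s1 XA1 RB1] mn.
have mn' C1 C2 : sep A e C1 C2 -> X \subset C1 -> R \subset C2 ->
    #|A1 :&: B1| <= #|C1 :&: C2|.
  by move=> h1 h2 h3; apply: (mn (C1, C2)); rewrite /Q /= h1 h2.
have oXA : #|X :&: A| = #|X| by rewrite (setIidPl XA).
have [oX1|oX1] := leqP #|X| #|A1 :&: B1|.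
  have := base X A sXA (subxx _) RA; rewrite oXA (setIidPl XA) UV; apply=> //.
  by move=> C1 C2 h1 h2 h3; apply: leq_trans oX1 (mn' _ _ h1 h2 h3).
have [s3 E3] := sep_lift_l es s s1 RB1.
apply: (rigid_knittable s3) => //; first by rewrite E3.
  apply: contraTneq oX1 => E; rewrite -leqNgt; apply: leq_trans oX _.
  apply/subset_leq_card; rewrite subsetI RB1 andbT.
  apply/subsetP=> x xR; apply: contraT => xA1.
  have : x \in (B1 :|: B) :\: A1 by rewrite in_setD xA1 in_setU (subsetP RB _ xR) orbT.
  by rewrite E inE.
by rewrite E3; apply: base => //; apply: ltnW.
Qed.
End Minimal.
End Massed.

(** * Contraction of an edge in few triangles *)

Section Contraction.
Variables (T : finType) (al l : nat).
Implicit Types (e : rel T) (D K V A B C X Y Z R S : {set T}) (x y : T).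

(* The edges at v lost when uv is contracted; edges inside X are not counted by
   massedness, hence the second alternative when u is in X. *)
Definition triangles V e X u v :=
  [set y in V | [&& e v y, y != u & e u y || (u \in X) && (y \in X)]].

(** With [D] the neighbours of [v] and [M] those that become new countable neighbours of [u],
    contraction loses at most [2 * #|D|] ordered pairs and gains [2 * #|M|]. The difference consists
    of [u] itself, the summand 1, and [triangles]. *)
Lemma pairs_contr V e X u v : symmetric e -> irreflexive e -> u \in V -> v \in V ->
    v \notin X -> e u v ->
  #|pairs V e (V :\: X)| <=
  #|pairs (V :\ v) (contr u v e) ((V :\ v) :\: X)| + 2 * (1 + #|triangles V e X u v|).
Proof.
move=> es ei uV vV vX euv; set V' := V :\ v; set e' := contr u v e.
set C := triangles V e X u v.
pose D := [set y in V | e v y].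
pose M := [set y in V | [&& e v y, y != u & ~~ (e u y || (u \in X) && (y \in X))]].
have DE : D \subset u |: (M :|: C).
  apply/subsetP=> y; rewrite /C !inE => /andP[-> ->].
  by case: (y == u) => //=; rewrite orNb.
have cD : #|D| <= 1 + #|M| + #|C|.
  apply: leq_trans (subset_leq_card DE) _; rewrite cardsU1.
  rewrite -addnA; apply: leq_add; first exact: leq_b1.
  exact: leq_of_leqif (leq_card_setU _ _).
have uv : u != v by apply: contraTneq euv => ->; rewrite ei.
pose P0 := pairs V' e (V' :\: X).
have up : #|pairs V e (V :\: X)| <= #|P0| + #|D| + #|D|.
  have : pairs V e (V :\: X) \subset (P0 :|: setX [set v] D) :|: [set (y, v) | y in D].
    apply/subsetP=> -[x y]; rewrite /P0 /V' !inE /= => /and4P[xV yV exy xyX].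
    have [xv|xv] := eqVneq x v; first by rewrite -xv yV exy orbT.
    have [yv|yv] := eqVneq y v.
      apply/orP; right; apply/imsetP; exists x; last by rewrite yv.
      by rewrite inE xV /= es -yv.
    by move: xyX; rewrite xV yV exy /= => ->.
  move/subset_leq_card => h; apply: leq_trans h _.
  apply: leq_trans (leq_of_leqif (leq_card_setU _ _)) _.
  apply: leq_add; last exact: leq_imset_card.
  apply: leq_trans (leq_of_leqif (leq_card_setU _ _)) _.
  by rewrite cardsX cards1 mul1n.
suff : #|P0| + #|M| + #|M| <= #|pairs V' e' (V' :\: X)| by lia.
have dn : P0 :|: setX [set u] M :|: setX M [set u] \subset pairs V' e' (V' :\: X).
  apply/subsetP=> -[x y]; rewrite 2!in_setU !in_setX /=.
  case/orP=> [/orP[|/andP[/set1P->]]|/andP[+ /set1P->]].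
  - by rewrite !inE /= => /and4P[-> -> exy ->]; rewrite /e' /contr exy.
  - rewrite inE => /and4P[yV evy yu]; rewrite negb_or negb_and => /andP[euy nX].
    have yv : y != v by apply: contraTneq evy => ->; rewrite ei.
    by rewrite !inE /= uV uv yV yv /e' /contr eqxx evy yu orbT /= !andbT.
  rewrite inE => /and4P[xV evx xu]; rewrite negb_or negb_and => /andP[eux nX].
  have xv : x != v by apply: contraTneq evx => ->; rewrite ei.
  by rewrite !inE /= uV uv xV xv /e' /contr eqxx evx xu !orbT /= !andbT orbC.
apply: leq_trans (subset_leq_card dn).
rewrite !cardsU.
have nP0 x y : (x, y) \in P0 -> e x y by rewrite inE => /and4P[].
have -> : (P0 :|: setX [set u] M) :&: setX M [set u] = set0.
  apply/setP=> -[x y]; rewrite in_setI in_setU !in_setX /= [RHS]inE; apply/negP.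
  case/andP=> + /andP[+ /set1P yu]; rewrite yu [x \in M]inE => + /and4P[_ _ xu].
  rewrite negb_or => + /andP[eux _].
  case/orP=> [/nP0|/andP[/set1P xu']]; first by rewrite es (negPf eux).
  by rewrite xu' eqxx in xu.
have -> : P0 :&: setX [set u] M = set0.
  apply/setP=> -[x y]; rewrite in_setI !in_setX /= [RHS]inE; apply/negP.
  case/andP=> /nP0 exy /andP[/set1P xu]; rewrite inE => /and4P[_ _ _].
  by rewrite -xu exy.
by rewrite !cardsX !cards1 cards0 !subn0 mul1n muln1.
Qed.

Section Minimal.
Variables (V : {set T}) (e : rel T) (X : {set T}).
Hypotheses (es : symmetric e) (ei : irreflexive e) (Xl : #|X| <= l).
Hypotheses (ms : massed al V e X) (IH : @IHmassed T al l #|V|).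

(** Massedness excludes smaller orders, so the order is [#|X|] and all smaller separations are
    sparse. Then [B] is massed over the cut, knitted by induction, and a target for [X]. *)
Lemma violation_knittable A B : sep V e A B -> X \subset A -> #|A :&: B| <= #|X| ->
  A :\: B != set0 -> 2 * al * #|B :\: A| < #|pairs V e (B :\: A)| -> knittable V e X.
Proof.
have [XV M1 M2] := ms; move=> s XA oX AB0 vio.
have [oX'|oX'] := leqP #|X| #|A :&: B|; last by have := M2 _ _ s XA oX'; rewrite leqNgt vio.
have kB : knittable B e (A :&: B).
  apply: IH => //.
  - case/set0Pn: AB0 => z /setDP[zA zB].
    apply: proper_card; apply/properP; split; first exact: sep_sub_r s.
    by exists z => //; apply: (subsetP (sep_sub_l s)).
  - exact: leq_trans oX Xl.
  apply: (massed_sub es s XA vio) => A' B' s' XA' o'.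
  by apply: M2 => //; apply: leq_trans o' oX.
apply: (target_knittable es ei Xl ms IH s XA oX').
by move=> S _ SR _; apply: knittable_sub SR kB.
Qed.

(** With fewer than [al] triangles, contracting [uv] loses at most [2 * al] pairs, just what one
    vertex fewer allows. A rigid separation of the contraction is pulled back by putting [v] on
    every side that contains [u]. *)
Lemma triangles_or_knittable u v : u \in V -> v \in V -> v \notin X -> e u v ->
  al <= #|triangles V e X u v| \/ knittable V e X.
Proof.
move=> uV vV vX euv; have [|cal] := leqP al #|triangles V e X u v|; first by left.
right; set V' := V :\ v; set e' := contr u v e.
have [XV M1 M2] := ms.
have es' : symmetric e' by apply: contr_sym.
have ei' : irreflexive e' by apply: contr_irr.
have ee' : subrel e e' by move=> x y; rewrite /e' /contr => ->.
have uv : u != v by apply: contraTneq euv => ->; rewrite ei.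
have cV' : #|V'|.+1 = #|V| by rewrite (cardsD1 v V) vV.
have VV' : v |: V' = V by rewrite setD1K.
have uV' : u \in V' by rewrite !inE uv.
have vV' : v \notin V' by rewrite !inE eqxx.
have XV' : X \subset V' by rewrite subsetD1 XV.
have M1' : 2 * al * #|V' :\: X| < #|pairs V' e' (V' :\: X)|.
  have := pairs_contr es ei uV vV vX euv; rewrite -/V' -/e'.
  have EX : #|V :\: X| = (#|V' :\: X|).+1.
    by have := cardsD_sub XV; have := cardsD_sub XV'; lia.
  move: M1 cal; rewrite EX mulnS; clear; lia.
have evE x : x != u -> e x v -> e' x u.
  by move=> xu exv; rewrite /e' /contr eqxx xu (es v x) exv !orbT.
suff [M2'|//] : sparse_seps al V' e' X \/ knittable V e X.
  rewrite -VV'; apply: (knittable_contr es uV' vV' euv XV').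
  by apply: IH; rewrite // -cV'.
have [||[A2 [B2 [s2 XA2 o2 v2 k2]]]] := @sparse_or_rigid _ al l #|V| V' e' X IH _ es' ei' Xl.
- by rewrite -cV'.
- by left.
right; have s2e : sep V' e A2 B2 by apply: sep_subrel s2.
have [U2 n2] := sepP _ _ _ _ s2.
have vA2 : v \notin A2 by apply: contra vV' => /(subsetP (sep_sub_l s2)).
have vB2 : v \notin B2 by apply: contra vV' => /(subsetP (sep_sub_r s2)).
have B20 : B2 :\: A2 != set0.
  apply: contraTneq v2 => ->; rewrite cards0 muln0 -leqNgt leqn0 cards_eq0.
  by apply/eqP/setP=> p; rewrite !inE !andbF.
have DB : (v |: B2) :\: A2 = v |: (B2 :\: A2).
  by apply/setP=> p; rewrite !inE; case: eqP => // ->; rewrite vA2.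
have [uA|uA] := boolP (u \in A2); last first.
  have uB : u \in B2 by move: uV'; rewrite -U2 inE (negPf uA).
  have s : sep V e A2 (v |: B2).
    apply/sepP; split; first by rewrite setUCA U2.
    move=> x y xA; rewrite !inE negb_or => /andP[xv xB] /orP[/eqP->|yB] yA.
      apply: contra (n2 _ _ xA xB uB uA); apply: evE.
      by apply: contraNneq xB => ->.
    by apply: contra (n2 _ _ xA xB yB yA); apply: ee'.
  have E : A2 :&: (v |: B2) = A2 :&: B2.
    by apply/setP=> p; rewrite !inE; case: eqP => // ->; rewrite (negPf vA2).
  apply: (rigid_knittable es ei Xl ms IH s) => //; rewrite ?E //.
    by rewrite DB; apply/set0Pn; exists v; rewrite !inE eqxx.
  by apply: (knittable_contr es uB vB2 euv) => //; apply: subsetIr.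
have [uB|uB] := boolP (u \in B2); last first.
  have s : sep V e (v |: A2) B2.
    apply/sepP; split; first by rewrite -setUA U2.
    move=> x y; rewrite !inE negb_or => /orP[/eqP->|xA] xB yB /andP[yv yA].
      rewrite es; apply: contra (n2 _ _ uA uB yB yA); rewrite (es' u); apply: evE.
      by apply: contraNneq yA => ->.
    by apply: contra (n2 _ _ xA xB yB yA); apply: ee'.
  have E : (v |: A2) :&: B2 = A2 :&: B2.
    by apply/setP=> p; rewrite !inE; case: eqP => // ->; rewrite (negPf vB2) !andbF.
  have E2 : B2 :\: (v |: A2) = B2 :\: A2.
    by apply/setP=> p; rewrite !inE; case: eqP => // ->; rewrite (negPf vB2) !andbF.
  have := M2 _ _ s (subset_trans XA2 (subsetUr _ _)); rewrite E E2 => /(_ o2).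
  have := pairs_sep es s; rewrite E2 => ->; rewrite leqNgt => /negP[].
  rewrite (pairs_sep es' s2) in v2; apply: leq_trans v2 _.
  apply/subset_leq_card/subsetP=> -[x y]; rewrite !inE /= => /and4P[xB yB + ->].
  rewrite xB yB /e' /contr; case/or3P=> [->//|/and3P[/eqP E' _ _]|/and3P[/eqP E' _ _]].
    by rewrite -E' xB in uB.
  by rewrite -E' yB in uB.
have s : sep V e (v |: A2) (v |: B2).
  apply/sepP; split; first by rewrite setUACA setUid U2.
  move=> x y; rewrite !inE !negb_or => /orP[/eqP->|xA] /andP[xv xB] /orP[/eqP->|yB] /andP[yv yA];
    rewrite ?eqxx // in xv yv *.
  by apply: contra (n2 _ _ xA xB yB yA); apply: ee'.
have EI : (v |: A2) :&: (v |: B2) = v |: (A2 :&: B2) by rewrite -setUIr.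
have ED : (v |: B2) :\: (v |: A2) = B2 :\: A2.
  apply/setP=> p; rewrite !inE negb_or; case: eqP => //= ->.
  by rewrite (negPf vB2) andbF.
have XA := subset_trans XA2 (subsetUr [set v] A2).
have oI : #|v |: (A2 :&: B2)| = #|A2 :&: B2|.+1 by rewrite cardsU1 inE (negPf vA2).
(* The cut has grown by [v], possibly to order [#|X|], so [violation_knittable] is needed. Pairs
   that exist only after contraction are mapped injectively to pairs at [v] by [phi]. *)
have vio : 2 * al * #|B2 :\: A2| < #|pairs V e (B2 :\: A2)|.
  apply: leq_trans v2 _.
  pose phi (p : T * T) := if e p.1 p.2 then p else if p.1 == u then (v, p.2) else (p.1, v).
  have inj : {in pairs V' e' (B2 :\: A2) &, injective phi}.
    move=> [x y] [x' y']; rewrite !inE /phi /=.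
    case/and4P=> /andP[xv xV] /andP[yv yV] exy xyY.
    case/and4P=> /andP[xv' xV'] /andP[yv' yV'] exy' xyY'.
    have vx := negPf xv; have vy := negPf yv; have vx' := negPf xv'; have vy' := negPf yv'.
    have kk1 : e x y = false -> x <> u -> y = u.
      by move=> c1 c2; move: exy; rewrite /e' /contr c1 /= (introF eqP c2) => /and3P[/eqP].
    have kk2 : e x' y' = false -> x' <> u -> y' = u.
      by move=> c1 c2; move: exy'; rewrite /e' /contr c1 /= (introF eqP c2) => /and3P[/eqP].
    case: ifP => c1; [|case: eqP => c2]; (case: ifP => d1; [|case: eqP => d2]) => h;
      have /= h1 := congr1 fst h; have /= h2 := congr1 snd h;
      try (by rewrite h1 h2); try (by rewrite h1 eqxx in vx); try (by rewrite -h1 eqxx in vx');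
      try (by rewrite h2 eqxx in vy); try (by rewrite -h2 eqxx in vy').
    - by rewrite c2 d2 h2.
    - by rewrite kk1 // kk2 // h1.
  rewrite -(card_in_imset inj); apply/subset_leq_card/subsetP=> _ /imsetP[[x y] + ->].
  rewrite !inE /phi /= => /and4P[/andP[xv xV] /andP[yv yV] exy xyY].
  case: ifP => c1 /=; first by rewrite xV yV c1.
  move: exy xyY; rewrite /e' /contr c1 /=; case/orP=> /and3P[/eqP-> ev nu].
    by rewrite uA eqxx /= vV yV ev => ->; rewrite orbT.
  by rewrite uA (negPf nu) /= orbF vV xV es ev => ->.
apply: (violation_knittable s XA); rewrite ?EI ?ED ?oI //.
have /set0Pn[z /setDP[zA zB]] := order_proper XA2 o2.
apply/set0Pn; exists z; rewrite !inE zA orbT (negPf zB) orbF andbT.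
by apply: contraNneq vA2 => <-.
Qed.
End Minimal.
End Contraction.

(** * Clusterings of the terminals *)

(** Packs a lexicographic comparison into one natural number. *)
Lemma lex_leq a b c d n : c <= n -> a * n.+1 + d <= b * n.+1 + c -> a <= b.
Proof.
move=> cn ab; rewrite leqNgt; apply/negP=> ba.
have : b.+1 * n.+1 <= a * n.+1 by rewrite leq_mul2r ba orbT.
by rewrite mulSn; lia.
Qed.

Section Clusters.
Variables (T : finType) (e : rel T) (V S : {set T}) (lab : T -> T) (w : nat -> nat).
Hypothesis SV : S \subset V.
Implicit Types (D A B : {set T}) (DD J : {set {set T}}) (x y : T).

Definition fib i := [set s in S | lab s == i].

Definition clustering DD := [&& trivIset DD, S \subset cover DD, cover DD \subset V &
  [forall D in DD, conn e D && [exists i, (D :&: S != set0) && (D :&: S \subset fib i)]]].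

Definition fam DD i := [set D in DD | D :&: fib i != set0].

(* The size of the clusters plus, for every label i, the budget w allots for
   merging the clusters of label i into one. *)
Definition weight DD := #|cover DD| + \sum_i w #|fam DD i|.

Lemma clusteringP DD : reflect [/\ trivIset DD, S \subset cover DD, cover DD \subset V &
    forall D, D \in DD -> conn e D /\ exists i, D :&: S != set0 /\ D :&: S \subset fib i]
  (clustering DD).
Proof.
apply: (iffP and4P) => -[h1 h2 h3 h4]; split=> //.
  move=> D DJ; move/forall_inP: h4 => /(_ _ DJ)/andP[cD /existsP[i /andP[i1 i2]]].
  by split=> //; exists i.
apply/forall_inP=> D /h4[cD [i [i1 i2]]]; rewrite cD; apply/existsP.
by exists i; rewrite i1 i2.
Qed.

Lemma card_trivIset_cond DD B : trivIset DD ->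
  #|cover DD :&: B| = \sum_(D in DD) #|D :&: B|.
Proof.
move=> tD; rewrite -sum1_card.
rewrite (eq_bigl (fun x => (x \in cover DD) && (x \in B))); last by move=> x; rewrite inE.
rewrite (big_trivIset_cond _ tD); apply: eq_bigr => D _.
by rewrite -sum1_card; apply: eq_bigl => x; rewrite inE.
Qed.

Lemma sum_fib : \sum_i #|fib i| = #|S|.
Proof.
rewrite -[RHS]sum1_card [RHS](partition_big lab xpredT) //=; apply: eq_bigr => i _.
by rewrite -sum1_card; apply: eq_bigl => x; rewrite inE.
Qed.

Definition singles := [set [set s] | s in S].

Lemma cover_singles : cover singles = S.
Proof.
apply/setP=> x; apply/bigcupP/idP => [[D /imsetP[s sS ->]]|xS].
  by move=> /set1P->.
by exists [set x]; rewrite ?set11 //; apply: imset_f.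
Qed.

Lemma singles_clustering : clustering singles.
Proof.
apply/clusteringP; rewrite cover_singles; split=> //.
  apply/trivIsetP=> _ _ /imsetP[x _ ->] /imsetP[y _ ->] nxy.
  by rewrite disjoints1 inE; apply: contraNneq nxy => ->.
move=> _ /imsetP[s sS ->]; split; first exact: conn1.
exists (lab s); split; first by apply/set0Pn; exists s; rewrite inE set11.
by apply/subsetP=> x; rewrite !inE => /andP[/eqP-> ->] /=.
Qed.

Lemma fam_singles i : #|fam singles i| = #|fib i|.
Proof.
rewrite -(card_imset _ (@set1_inj T)); apply: eq_card => D.
rewrite inE; apply/andP/imsetP => [[/imsetP[s sS ->] /set0Pn[x]]|[s + ->]].
  by rewrite !inE => /andP[/eqP-> h]; exists s; rewrite ?inE.
rewrite inE => /andP[sS ls]; split; first exact: imset_f.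
by apply/set0Pn; exists s; rewrite !inE eqxx sS.
Qed.

(* Replaces the clusters in J by the single cluster D'. *)
Lemma surgery DD J D' i : clustering DD -> J \subset DD -> J != set0 ->
    (forall D, D \in J -> D :&: S \subset fib i) -> conn e D' -> D' \subset V ->
    D' :&: cover DD \subset cover J -> cover J :&: S \subset D' ->
  let DD' := D' |: (DD :\: J) in
  [/\ clustering DD', #|DD'| + #|J| = #|DD|.+1,
      #|cover DD'| + #|cover J| = #|cover DD| + #|D'|,
      #|fam DD' i| + #|J| = #|fam DD i|.+1 &
      forall j, j != i -> fam DD' j = fam DD j].
Proof.
move=> /clusteringP[tD SD DV pD] JD0 J0 Ji cD' DV' D'J SJ DD'; have JD := subsetP JD0.
have SJ' x : x \in S -> x \in D' -> x \in cover J.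
  by move=> xS xD; apply: (subsetP D'J); rewrite inE xD (subsetP SD).
have dJ D x : D \in DD -> D \notin J -> x \in D -> x \notin cover J.
  move=> DDD DJ xD; apply: contra DJ => /bigcupP[D1 D1J x1].
  by rewrite (trivIset_eq tD DDD (JD _ D1J) xD x1).
have dD' D x : D \in DD -> D \notin J -> x \in D -> x \notin D'.
  move=> DDD DJ xD; apply: contra (dJ _ _ DDD DJ xD) => xD'.
  by apply: (subsetP D'J); rewrite inE xD'; apply/bigcupP; exists D.
have [D0 D0J] := set0Pn _ J0.
have [_ [i0 [/set0Pn[s0] + _]]] := pD _ (JD _ D0J).
rewrite inE => /andP[s0D s0S].
have s0J : s0 \in cover J by apply/bigcupP; exists D0.
have s0D' : s0 \in D' by apply: (subsetP SJ); rewrite inE s0J.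
have D'n : D' \notin DD :\: J.
  by rewrite inE; apply/negP=> /andP[h1 h2]; have := dD' _ _ h2 h1 s0D'; rewrite s0D'.
have cDJ : #|DD :\: J| + #|J| = #|DD|.
  by have := cardsID J DD; rewrite (setIidPr JD0) addnC.
have jfib x j : x \in cover J -> x \in S -> lab x == j -> j = i.
  move=> /bigcupP[D DJ xD] xS /eqP <-.
  have : x \in fib i by apply: (subsetP (Ji _ DJ)); rewrite inE xD.
  by rewrite inE => /andP[_ /eqP].
have DS' : D' :&: S \subset fib i.
  apply/subsetP=> x; rewrite in_setI => /andP[xD xS].
  have /bigcupP[D DJ xD1] := SJ' _ xS xD.
  by apply: (subsetP (Ji _ DJ)); rewrite inE xD1.
have EDD' : cover DD' = D' :|: cover (DD :\: J).
  by rewrite /cover /DD' bigcup_setU big_set1.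
have Ecov : cover (DD :\: J) = cover DD :\: cover J.
  apply/setP=> x; rewrite inE; apply/bigcupP/andP => [[D /setDP[DDD DJ] xD]|[xJ /bigcupP[D DDD xD]]].
    by split; [apply: dJ DDD DJ xD|apply/bigcupP; exists D].
  exists D => //; rewrite inE DDD andbT; apply: contra xJ => DJ.
  by apply/bigcupP; exists D.
have JDD : cover J \subset cover DD.
  by apply/bigcupsP=> D /JD DDD; apply: bigcup_sup.
split.
- apply/clusteringP; split.
  + apply/trivIsetP=> D1 D2; rewrite !in_setU1 !in_setD.
    have sd D : D \notin J -> D \in DD -> [disjoint D' & D].
      move=> h1 h2; rewrite disjoint_sym disjoint_subset; apply/subsetP=> x xD.
      by rewrite inE; apply: dD' xD.
    case/orP=> [/eqP->|/andP[h1 h2]]; case/orP=> [/eqP->|/andP[h3 h4]].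
    * by rewrite eqxx.
    * by move=> _; apply: sd.
    * by move=> _; rewrite disjoint_sym; apply: sd.
    * by move/trivIsetP: tD; apply.
  + rewrite EDD' Ecov; apply/subsetP=> x xS; rewrite !inE (subsetP SD) // andbT.
    case xJ: (x \in cover J); last by rewrite orbT.
    by rewrite (subsetP SJ) // inE xJ.
  + by rewrite EDD' Ecov subUset DV' (subset_trans (subsetDl _ _)).
  move=> D; rewrite in_setU1 => /orP[/eqP->|/setDP[h _]]; last exact: pD.
  split=> //; exists i; split=> //.
  by apply/set0Pn; exists s0; rewrite inE s0D'.
- by rewrite cardsU1 D'n -cDJ.
- rewrite EDD' Ecov cardsU.
  have -> : D' :&: (cover DD :\: cover J) = set0.
    apply/setP=> x; rewrite !inE; apply/negP=> /and3P[h1 h2 h3].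
    by move: h2; rewrite (subsetP D'J) // inE h1.
  rewrite cards0 subn0; have := cardsID (cover J) (cover DD).
  by rewrite (setIidPr JDD); clear; lia.
- have Ef : fam DD' i = D' |: (fam DD i :\: J).
    apply/setP=> D; rewrite [LHS]inE [in RHS]in_setU1 [in RHS]in_setD [D \in fam _ _]inE.
    rewrite in_setU1 in_setD; case: eqP => [->|_] /=; last by rewrite andbA.
    by apply/set0Pn; exists s0; rewrite inE s0D' (subsetP DS') // inE s0D'.
  have Jf : J \subset fam DD i.
    apply/subsetP=> D DJ; rewrite inE JD //=.
    have [_ [i1 [/set0Pn[s sD] _]]] := pD _ (JD _ DJ).
    apply/set0Pn; exists s; rewrite inE (subsetP (Ji _ DJ)) //.
    by move: sD; rewrite inE => /andP[->].
  have D'f : D' \notin fam DD i :\: J.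
    by apply: contra D'n; rewrite !inE => /andP[-> /andP[-> _]].
  rewrite Ef cardsU1 D'f; have := cardsID J (fam DD i).
  by rewrite (setIidPr Jf); clear; lia.
move=> j ji; apply/setP=> D; rewrite [LHS]inE [RHS]inE in_setU1 in_setD.
have nj D1 : D1 :&: S \subset fib i -> D1 :&: fib j = set0.
  move=> /subsetP h; apply/setP=> x; rewrite !inE; apply/negP=> /and3P[xD xS /eqP lj].
  by have := h x; rewrite !inE xD xS => /(_ isT)/eqP li; rewrite -lj li eqxx in ji.
have [->|_] := eqVneq D D'.
  by rewrite nj // eqxx !andbF.
case DJ: (D \in J) => //=; by rewrite nj ?eqxx ?andbF //; apply: Ji.
Qed.

Lemma card_clustering DD : clustering DD -> #|DD| <= #|S|.
Proof.
case/clusteringP=> tD SD _ pD.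
rewrite -[in X in _ <= X](setIidPr SD) card_trivIset_cond // -sum1_card; apply: leq_sum => D /pD[_ [k [h _]]].
by rewrite card_gt0.
Qed.

(** Minimise the weight first and the number of clusters second; comparison with [singles] bounds
    the weight. The term [1 < #|J|] is the tie-break: a genuine merger lowers the number of
    clusters, so it must strictly raise the weight. *)
Lemma min_clustering : exists DD, [/\ clustering DD,
  weight DD <= #|S| + \sum_i w #|fib i| &
  forall i J D', J \subset DD -> J != set0 ->
    (forall D, D \in J -> D :&: S \subset fib i) -> conn e D' -> D' \subset V ->
    D' :&: cover DD \subset cover J -> cover J :&: S \subset D' ->
    #|cover J| + w #|fam DD i| + (1 < #|J|) <= #|D'| + w (#|fam DD i|.+1 - #|J|)].
Proof.
pose pot DD := weight DD * #|S|.+1 + #|DD|.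
case: (arg_minnP pot singles_clustering) => DD cDD mn.
exists DD; split=> //.
  have := mn _ singles_clustering; rewrite /pot.
  have -> : weight singles = #|S| + \sum_i w #|fib i|.
    by rewrite /weight cover_singles; congr (_ + _); apply: eq_bigr => i _; rewrite fam_singles.
  by apply: lex_leq; apply: leq_imset_card.
move=> i J D' JD J0 Ji cD DV h1 h2.
have [cl' c1 c2 c3 c4] := surgery cDD JD J0 Ji cD DV h1 h2.
set DD' := D' |: _ in cl' c1 c2 c3 c4; have := mn _ cl'.
have J1 : 0 < #|J| by rewrite card_gt0.
rewrite /pot /weight (bigD1 i) //= [in X in _ <= X](bigD1 i) //=.
have -> : \sum_(j | j != i) w #|fam DD' j| = \sum_(j | j != i) w #|fam DD j|.
  by apply: eq_bigr => j /c4->.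
have -> : #|fam DD' i| = #|fam DD i|.+1 - #|J| by rewrite -c3 addnK.
set a := w _; set b := w _; set c := \sum_(_ | _) _ => H.
have le := lex_leq (card_clustering cl') H.
rewrite leqNgt; apply/negP=> lt; move: H le lt c1 c2 J1.
move: #|DD| #|cover DD| #|cover J| #|cover DD'| #|D'| #|J| #|DD'| #|S|.
clear => d cd cj cd' d' k dd n H le lt c1 c2 k1.
have E : cd + (a + c) = cd' + (b + c) by case: (1 < k) lt => /=; lia.
have : 1 < k by case: leqP lt => /=; lia.
by move: H; rewrite E leq_add2l; lia.
Qed.
End Clusters.

(** * Rerouting a cluster through an outside vertex *)

Section Rerouting.
Variables (T : finType) (e : rel T).
Hypotheses (es : symmetric e) (ei : irreflexive e).
Implicit Types (D A B Q : {set T}) (a x y : T).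

Definition nb A a := [set y in A | e a y].

(** From each element of [Q], walk in [D] up to the first neighbour of [a]. Together with [a] these
    pieces form a connected set with at most one neighbour of [a] per element of [Q]. *)
Lemma reroute D Q a : conn e D -> Q \subset D -> a \notin D -> nb D a != set0 ->
  exists D', [/\ conn e D', a |: Q \subset D', D' \subset a |: D & #|nb D' a| <= #|Q|].
Proof.
move=> cD QD aD N0.
have ex s : exists p : {set T} * T, s \in Q -> [/\ p.1 \subset D, conn e p.1,
    s \in p.1, p.1 :&: nb D a = [set p.2] & p.2 \in nb D a].
  have [sQ|] := boolP (s \in Q); last by exists (set0, s).
  have [|D' [y h]] := @conn_meet_once _ e D (nb D a) s es cD (subsetP QD _ sQ).
  - by apply: contra_neq N0 => <-; apply/esym/setIidPr/subsetP=> y; rewrite inE => /andP[].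
  by exists (D', y).
have [p hp] := fin_all_exists ex.
pose D' := a |: \bigcup_(s in Q) (p s).1.
have sD' s : s \in Q -> (p s).1 \subset D'.
  by move=> sQ; apply: subset_trans (subsetUr _ _); exact: (bigcup_sup s).
exists D'; split.
- apply: (conn_from es (x := a)); first by rewrite !inE eqxx.
  move=> z /setU1P[->//|/bigcupP[s sQ zs]].
  have [s1 /connP[_ c] _ E yN] := hp s sQ.
  have yp : (p s).2 \in (p s).1 :&: nb D a by rewrite E set11.
  rewrite inE in yp; case/andP: yp => yp _.
  apply: (@connect_trans _ _ (p s).2).
    apply: connect1; rewrite /= !inE eqxx /=; move: yN; rewrite inE => /andP[_ ->].
    by rewrite andbT; move/subsetP: (sD' _ sQ) => /(_ _ yp); rewrite !inE.
  by apply: connect_restrS (sD' _ sQ) _ _ _; apply: c.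
- rewrite setUS //; apply/subsetP=> s sQ; apply/bigcupP; exists s => //.
  by case: (hp s sQ).
- by rewrite setUS //; apply/bigcupsP=> s sQ; case: (hp s sQ).
apply: leq_trans (leq_imset_card (fun s => (p s).2) _); apply: subset_leq_card.
apply/subsetP=> y; rewrite inE => /andP[/setU1P[->|/bigcupP[s sQ ys]] eay].
  by rewrite ei in eay.
have [s1 _ _ E _] := hp s sQ; apply/imsetP; exists s => //.
by apply/set1P; rewrite -E inE ys inE eay (subsetP s1).
Qed.
End Rerouting.

(** * Consequences of a minimal clustering *)

Section Minimal.
Variables (T : finType) (e : rel T) (V S : {set T}) (lab : T -> T) (w : nat -> nat).
Hypotheses (es : symmetric e) (ei : irreflexive e) (SV : S \subset V).
Variable DD : {set {set T}}.
Hypothesis cDD : clustering e V S lab DD.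
Hypothesis minDD : forall i (J : {set {set T}}) (D' : {set T}), J \subset DD -> J != set0 ->
    (forall D, D \in J -> D :&: S \subset fib S lab i) -> conn e D' -> D' \subset V ->
    D' :&: cover DD \subset cover J -> cover J :&: S \subset D' ->
    #|cover J| + w #|fam S lab DD i| + (1 < #|J|) <= #|D'| + w (#|fam S lab DD i|.+1 - #|J|).
Implicit Types (D A B Z : {set T}) (J : {set {set T}}) (x y a : T).
Local Notation W := (V :\: cover DD).
Local Notation fam i := (fam S lab DD i).

Lemma fam_fib D i : D \in fam i -> D \in DD /\ D :&: S \subset fib S lab i.
Proof.
have [tD SD DV pD] := clusteringP _ _ _ _ _ cDD.
rewrite inE => /andP[DDD /set0Pn[x]]; rewrite !inE => /and3P[xD xS /eqP lx].
split=> //; have [_ [j [_ /subsetP h]]] := pD _ DDD.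
apply/subsetP=> y yDS; have := h _ yDS; have := h x; rewrite !inE xD xS.
by move=> /(_ isT)/=/eqP; rewrite lx => ->.
Qed.

Lemma cluster_le D D' : D \in DD -> conn e D' -> D' \subset D :|: W -> D :&: S \subset D' ->
  #|D| <= #|D'|.
Proof.
have [tD SD DV pD] := clusteringP _ _ _ _ _ cDD.
move=> DDD cD' D'D DS; have [_ [i [_ Di]]] := pD _ DDD.
have cD1 : cover [set D] = D by rewrite /cover big_set1.
have := minDD (i := i) (J := [set D]) (D' := D'); rewrite sub1set cD1 cards1 subn1 => H.
suff : #|D| + w #|fam i| + (1 < 1) <= #|D'| + w #|fam i| by rewrite addn0 leq_add2r.
apply: H => //.
- by apply/set0Pn; exists D; rewrite set11.
- by move=> D1 /set1P->.
- apply: subset_trans D'D _; rewrite subUset subsetDl andbT.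
  by apply: subset_trans DV; apply: bigcup_sup.
apply/subsetP=> x; rewrite inE => /andP[/(subsetP D'D)].
by rewrite in_setU in_setD => /orP[//|/andP[/negPf->]].
Qed.

(** With a single terminal, that singleton would be a cheaper cluster. *)
Lemma cluster_two D : D \in DD -> ~~ (D \subset S) -> 2 <= #|D :&: S|.
Proof.
have [tD SD DV pD] := clusteringP _ _ _ _ _ cDD.
move=> DDD nDS; have [_ [i [D0 _]]] := pD _ DDD.
rewrite ltn_neqAle card_gt0 D0 andbT eq_sym; apply/negP=> /cards1P[s E].
have sD : s \in D :&: S by rewrite E set11.
have [sD1 sS] := setIP sD.
have := @cluster_le D [set s] DDD (conn1 e s); rewrite cards1 E subxx sub1set inE sD1.
move=> /(_ isT isT) D1; case/negP: nDS; suff -> : D = [set s] by rewrite sub1set.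
by apply/eqP; rewrite eq_sym eqEcard sub1set sD1 cards1.
Qed.

(* A vertex a with more neighbours in D could reroute D: the paths from the
   terminals of D to a, each stopped at its first neighbour of a, leave out at
   least two vertices of D. *)
Lemma cluster_nb D a : D \in DD -> a \in W ->
  #|nb e D a| <= #|D :&: S| + ~~ (D \subset S).
Proof.
have [tD SD DV pD] := clusteringP _ _ _ _ _ cDD.
move=> DDD /setDP[aV aU]; have [cD _] := pD _ DDD.
have nbD : nb e D a \subset D by apply/subsetP=> y; rewrite inE => /andP[].
have [DS|nDS] := boolP (D \subset S).
  by rewrite addn0 (setIidPl DS) subset_leq_card.
have [->|N0] := eqVneq (nb e D a) set0; first by rewrite cards0.
have aD : a \notin D by apply: contra aU => aD; apply/bigcupP; exists D.
have [D' [cD' QD' D'D nbD']] := reroute es ei cD (subsetIl D S) aD N0.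
have aD' : a \in D' by apply: (subsetP QD'); rewrite !inE eqxx.
have le : #|D| <= #|D'|.
  apply: cluster_le => //; last by apply: subset_trans QD'; apply: subsetUr.
  apply: subset_trans D'D _; rewrite subUset sub1set subsetUl andbT.
  by rewrite in_setU in_setD aU aV orbT.
have sub : nb e D a \subset nb e D' a :|: (D :\: D').
  apply/subsetP=> y; rewrite !inE => /andP[-> ->].
  by rewrite !andbT orbN.
apply: leq_trans (subset_leq_card sub) _.
apply: leq_trans (leq_of_leqif (leq_card_setU _ _)) _; apply: leq_add => //=.
have E : D' = a |: (D :&: D').
  apply/setP=> y; rewrite !inE; case: eqP => [->//|/= ya].
  case yD': (y \in D'); rewrite ?andbF // andbT; apply/esym.
  by have := subsetP D'D _ yD'; rewrite !inE; case: eqP ya.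
have : #|D'| = (#|D :&: D'|).+1 by rewrite [in LHS]E cardsU1 inE (negPf aD).
by have := cardsID D' D; move: le; clear; lia.
Qed.

Lemma total_nb a : a \in W ->
  #|nb e (cover DD) a| <= #|S| + \sum_(D in DD) ~~ (D \subset S).
Proof.
have [tD SD DV pD] := clusteringP _ _ _ _ _ cDD.
move=> aW; have -> : #|S| = \sum_(D in DD) #|D :&: S|.
  by rewrite -card_trivIset_cond // (setIidPr SD).
have -> : nb e (cover DD) a = cover DD :&: [set y | e a y].
  by apply/setP=> y; rewrite !inE.
rewrite card_trivIset_cond // -big_split /=; apply: leq_sum => D DDD.
apply: leq_trans (cluster_nb DDD aW); apply: subset_leq_card.
by apply/subsetP=> y; rewrite !inE.
Qed.

Lemma total_eps : 2 * (\sum_(D in DD) ~~ (D \subset S)) <= #|S|.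
Proof.
have [tD SD DV pD] := clusteringP _ _ _ _ _ cDD.
rewrite -[in X in _ <= #|X|](setIidPr SD) card_trivIset_cond // big_distrr /=.
apply: leq_sum => D DDD; case: (boolP (D \subset S)) => //= h; exact: cluster_two.
Qed.

Lemma total_cover : #|S| + \sum_(D in DD) ~~ (D \subset S) <= #|cover DD|.
Proof.
have [tD SD DV pD] := clusteringP _ _ _ _ _ cDD.
rewrite -[in X in #|X| + _](setIidPr SD) -[in X in _ <= #|X|](setIid (cover DD)).
rewrite !card_trivIset_cond // -big_split /=; apply: leq_sum => D DDD.
rewrite [D :&: cover _](setIidPl _); last exact: bigcup_sup.
rewrite -(cardsID S D) leq_add2l; case: (boolP (D \subset S)) => //= h.
by rewrite card_gt0 setD_eq0.
Qed.

(** The merged clusters keep their vertices, so a merger costs only [#|Z|]. Taken contrapositively,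
    it is possible whenever the budget [w] pays for [Z]. *)
Lemma join_clusters i J Z : J \subset fam i -> 1 < #|J| -> Z \subset W ->
  conn e (cover J :|: Z) -> w #|fam i| < #|Z| + w (#|fam i|.+1 - #|J|).
Proof.
have [tD SD DV pD] := clusteringP _ _ _ _ _ cDD.
move=> /subsetP Jf J1 ZW cJ.
have JD : J \subset DD by apply/subsetP=> D /Jf/fam_fib[].
have JDD : cover J \subset cover DD.
  by apply/bigcupsP=> D /(subsetP JD) DDD; apply: bigcup_sup.
have := minDD (i := i) (J := J) (D' := cover J :|: Z) JD; rewrite J1 => H.
have cU : #|cover J :|: Z| <= #|cover J| + #|Z| := leq_of_leqif (leq_card_setU _ _).
suff : #|cover J| + w #|fam i| + true <= #|cover J :|: Z| + w (#|fam i|.+1 - #|J|).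
  by move: cU; clear; rewrite /=; lia.
apply: H => //.
- by rewrite -card_gt0 ltnW.
- by move=> D /Jf/fam_fib[].
- by rewrite subUset (subset_trans JDD) // (subset_trans ZW) ?subsetDl.
- apply/subsetP=> x /setIP[/setUP[//|/(subsetP ZW)]].
  by rewrite in_setD => /andP[/negPf->].
- by apply: subset_trans (subsetUl _ _); apply: subsetIl.
Qed.

Lemma join_two i D1 D2 Z a1 a2 x1 x2 : D1 \in fam i -> D2 \in fam i -> D1 != D2 ->
  Z \subset W -> conn e Z -> a1 \in Z -> a2 \in Z -> x1 \in D1 -> x2 \in D2 ->
  e a1 x1 -> e a2 x2 -> w #|fam i| < #|Z| + w #|fam i|.-1.
Proof.
have [tD SD DV pD] := clusteringP _ _ _ _ _ cDD.
move=> F1 F2 n12 ZW cZ a1Z a2Z x1D x2D e1 e2.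
have c2 : #|[set D1; D2]| = 2 by rewrite cards2 n12.
have := @join_clusters i [set D1; D2] Z; rewrite c2 subSS subn1; apply=> //.
  by rewrite subUset !sub1set F1.
have -> : cover [set D1; D2] = D1 :|: D2 by rewrite /cover bigcup_setU !big_set1.
have [C1 _] := pD _ (fam_fib F1).1; have [C2 _] := pD _ (fam_fib F2).1.
have cZ1 : conn e (Z :|: D1) by apply: (connU es cZ C1 a1Z x1D); rewrite e1 orbT.
rewrite setUC setUA; apply: (connU es cZ1 C2 (x := a2) _ x2D); last by rewrite e2 orbT.
by rewrite inE a2Z.
Qed.

Lemma join_adjacent i D1 D2 x1 x2 : D1 \in fam i -> D2 \in fam i -> D1 != D2 ->
  x1 \in D1 -> x2 \in D2 -> e x1 x2 -> w #|fam i| < w #|fam i|.-1.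
Proof.
have [tD SD DV pD] := clusteringP _ _ _ _ _ cDD.
move=> F1 F2 n12 x1D x2D e12.
have c2 : #|[set D1; D2]| = 2 by rewrite cards2 n12.
have := @join_clusters i [set D1; D2] set0; rewrite c2 subSS subn1 cards0 add0n; apply=> //.
- by rewrite subUset !sub1set F1.
- exact: sub0set.
have -> : cover [set D1; D2] = D1 :|: D2 by rewrite /cover bigcup_setU !big_set1.
have [C1 _] := pD _ (fam_fib F1).1; have [C2 _] := pD _ (fam_fib F2).1.
by rewrite setU0; apply: (connU es C1 C2 x1D x2D); rewrite e12 orbT.
Qed.

Lemma clusters_knit : (forall i, #|fam i| <= 1) -> knit V e S lab.
Proof.
have [tD SD DV pD] := clusteringP _ _ _ _ _ cDD.
move=> f1.
pose g x := if [pick s in pblock DD x :&: S] is Some s then lab s else x.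
have gD D : D \in DD -> exists i, [/\ {in D, forall x, g x = i}, D \in fam i &
    {in S, forall s, s \in D -> lab s = i}].
  move=> DDD; have [_ [i [/set0Pn[s sDS] /subsetP Di]]] := pD _ DDD.
  exists i; split.
  - move=> x xD; rewrite /g (def_pblock tD DDD xD); case: pickP => [t|/(_ s)]; last by rewrite sDS.
    by move/Di; rewrite inE => /andP[_ /eqP].
  - rewrite inE DDD; apply/set0Pn; exists s; rewrite inE Di // andbT.
    by case/setIP: sDS.
  - move=> t tS tD'; have := Di t; rewrite !inE tS tD' => /(_ isT).
    by move/eqP.
exists g; split=> [s sS|s t sS tS st].
  have sc := subsetP SD _ sS; have [i [g1 _ g2]] := gD _ (pblock_mem sc).
  by rewrite g1 ?g2 // mem_pblock.
have sc := subsetP SD _ sS; have tc := subsetP SD _ tS.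
have D1 := pblock_mem sc; have D2 := pblock_mem tc.
have s1 : s \in pblock DD s by rewrite mem_pblock.
have t1 : t \in pblock DD t by rewrite mem_pblock.
have [i [gi Fi li]] := gD _ D1; have [j [gj Fj lj]] := gD _ D2.
have ij : i = j by rewrite -(li s) // -(lj t).
have EP : pblock DD s = pblock DD t.
  by apply: (card_le1_eqP (f1 i)); rewrite ?ij // -ij.
have [/connP[_ c] _] := pD _ D1.
apply: (connect_mono_restr _ gi); last by apply: c; rewrite // EP.
by apply: subset_trans DV; exact: (bigcup_sup (pblock DD s)).
Qed.
End Minimal.

(** * Dense graphs *)

Section Dense.
Variables (T : finType) (e : rel T).
Hypotheses (es : symmetric e) (ei : irreflexive e).
Implicit Types (A B D S U V Z : {set T}) (a b x y : T) (lab : T -> T).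

Lemma card_nbD V U a : U \subset V ->
  #|nb e V a| = #|nb e U a| + #|nb e (V :\: U) a|.
Proof.
move=> UV; rewrite -(cardsID U (nb e V a)); congr (_ + _); apply: eq_card => x.
  by rewrite !inE; case xU: (x \in U); rewrite ?andbF // (subsetP UV) //= andbT.
by rewrite !inE; case: (x \in U).
Qed.

(** The ratio [d / c] is the number of extra vertices spent per terminal. *)
Lemma cover_bound V S lab w DD c d : clustering e V S lab DD ->
  weight S lab w DD <= #|S| + \sum_i w #|fib S lab i| ->
  (forall m, c * w m <= d * m) -> c * #|cover DD| <= (c + d) * #|S|.
Proof.
move=> cDD h hw; have h1 : #|cover DD| <= #|S| + \sum_i w #|fib S lab i|.
  by apply: leq_trans h; apply: leq_addr.
have h2 : c * \sum_i w #|fib S lab i| <= d * #|S|.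
  by rewrite -(sum_fib S lab) !big_distrr /=; apply: leq_sum => i _; apply: hw.
apply: leq_trans (_ : c * (#|S| + \sum_i w #|fib S lab i|) <= _).
  by rewrite leq_mul2l h1 orbT.
by rewrite mulnDr mulnDl leq_add2l.
Qed.

Definition ball V a := [set x in V | (x == a) || e a x].

Lemma card_ball V a : a \in V -> #|ball V a| = #|nb e V a|.+1.
Proof.
move=> aV; have -> : ball V a = a |: nb e V a.
  by apply/setP=> x; rewrite !inE; case: eqP => [->|]; rewrite ?aV.
by rewrite cardsU1 inE ei andbF.
Qed.

Lemma ball_refl V a : a \in V -> a \in ball V a.
Proof. by move=> aV; rewrite inE aV eqxx. Qed.

Lemma mem_ball V a x : x \in ball V a -> (x == a) || e a x.
Proof. by rewrite inE => /andP[]. Qed.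

Lemma ball_sub V a : ball V a \subset V.
Proof. by apply/subsetP=> x; rewrite inE => /andP[]. Qed.

(* Allows joining two of at least three clusters with 3 vertices and the last two
   with 6, for at most 3 vertices per terminal in total. *)
Definition w_half m := if m <= 1 then 0 else 3 * m.

Lemma w_half_pred m : 1 < m -> 3 + w_half m.-1 <= w_half m.
Proof. by rewrite /w_half; do 2 case: ifP; lia. Qed.

(* Three vertices outside the clusters cannot have disjoint balls, so when two
   clusters cannot be joined, the balls of radius two around their neighbours a
   and b cover everything outside and have no edges between them. *)
Lemma half_or_knit V S lab l : S \subset V -> #|V| <= 8 * l + 1 -> #|S| <= l ->
    (forall h, h \in V -> h \notin S -> 4 * l + 1 <= #|nb e V h|) ->
    (forall U s, S \subset U -> U \subset V -> #|U| <= 4 * l -> s \in S ->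
       exists2 a, a \in V :\: U & e s a) ->
  knit V e S lab \/ exists A r, [/\ A != set0, A \subset V :\: S,
    2 * r <= #|S|, 2 * #|A| + #|S| + r <= 8 * l + 1 &
    forall a, a \in A -> 4 * l + 1 <= #|nb e A a| + #|S| + r].
Proof.
move=> SV Vl Sl degV degS.
have [DD [cDD wDD mDD]] := min_clustering e lab w_half SV.
have [tD SD DV pD] := clusteringP _ _ _ _ _ cDD.
pose W := V :\: cover DD; pose r := \sum_(D in DD) ~~ (D \subset S).
have cU : #|cover DD| <= 4 * l.
  have := cover_bound (c := 1) (d := 3) cDD wDD; rewrite !mul1n => /(_ _) h.
  apply: leq_trans (h _) _; last by rewrite leq_mul2l Sl orbT.
  by move=> m; rewrite mul1n /w_half; case: ifP.
have r2 : 2 * r <= #|S| := total_eps cDD mDD.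
have rU : #|S| + r <= #|cover DD| := total_cover cDD.
have cW : #|W| + #|cover DD| = #|V|.
  by rewrite -(cardsID (cover DD) V) (setIidPr DV) addnC.
have degW a : a \in W -> 4 * l + 1 <= #|nb e W a| + #|S| + r.
  move=> aW; have := total_nb es ei cDD mDD aW; rewrite -/r.
  have := card_nbD a DV; rewrite -/W => E.
  have := degV a; case/setDP: (aW) => aV aU.
  rewrite aV (contra (subsetP SD a) aU) E => /(_ isT isT).
  clear; lia.
(* Write t for [#|S| + r]. Each ball has at least 4l + 2 - t vertices and [W] at most 8l + 1 - t, so
   three disjoint balls would give 4l + 5 <= 2t <= 3l. *)
have balls a b c : a \in W -> b \in W -> c \in W -> [disjoint ball W a & ball W b] ->
    [disjoint ball W a & ball W c] -> [disjoint ball W b & ball W c] -> False.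
  move=> aW bW cW' dab dac dbc.
  have : ball W a :|: ball W b :|: ball W c \subset W by rewrite 2!subUset !ball_sub.
  move/subset_leq_card; rewrite !cardsU setIUl.
  rewrite (disjoint_setI0 dab) (disjoint_setI0 dac) (disjoint_setI0 dbc) setU0 cards0 !subn0.
  rewrite !card_ball //; have := degW _ aW; have := degW _ bW; have := degW _ cW'.
  move: r2 rU cW Vl Sl; clear; lia.
have nbW i D : D \in fam S lab DD i -> exists a x, [/\ a \in W, x \in D & e a x].
  move=> /(fam_fib cDD)[DDD _]; have [_ [j [/set0Pn[s /setIP[sD sS]] _]]] := pD _ DDD.
  have [a aW esa] := degS _ s SD DV cU sS.
  by exists a, s; rewrite es.
have cball a x : a \in W -> x \in ball W a ->
    [set a; x] \subset W /\ conn e [set a; x].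
  move=> aW xB; split; first by rewrite subUset !sub1set aW (subsetP (ball_sub W a)).
  apply: (connU es (conn1 e a) (conn1 e x) (set11 a) (set11 x)).
  by rewrite eq_sym (mem_ball xB).
(* A common vertex [x] of the balls gives a connector on [a], [x], [b], and the budget pays for 3
   vertices. *)
have dist i D1 D2 a b x1 x2 : D1 \in fam S lab DD i -> D2 \in fam S lab DD i -> D1 != D2 ->
    a \in W -> b \in W -> x1 \in D1 -> x2 \in D2 -> e a x1 -> e b x2 ->
    [disjoint ball W a & ball W b].
  move=> F1 F2 n12 aW bW x1D x2D e1 e2; rewrite -setI_eq0; apply: contraT.
  case/set0Pn=> x /setIP[xa xb].
  have [s1 c1] := cball _ _ aW xa; have [s2 c2] := cball _ _ bW xb.
  have cZ : conn e ([set a; x] :|: [set b; x]).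
    by apply: (connU es c1 c2 (x := x) (y := x)); rewrite ?set22 ?eqxx.
  have ZW : [set a; x] :|: [set b; x] \subset W by rewrite subUset s1.
  have := join_two es cDD mDD F1 F2 n12 ZW cZ (a1 := a) (a2 := b) _ _ x1D x2D e1 e2.
  rewrite !inE !eqxx !orbT => /(_ isT isT).
  have : #|[set a; x] :|: [set b; x]| <= 3.
    have -> : [set a; x] :|: [set b; x] = [set a; b; x].
      by apply/setP=> y; rewrite !inE; do 3 case: (y == _).
    rewrite setUC cardsU1 cards2; apply: (@leq_add _ _ 1 2); first exact: leq_b1.
    by case: (a != b).
  have : 1 < #|fam S lab DD i| by apply/card_gt1P; exists D1, D2.
  by move/w_half_pred; clear; lia.
have [f1|] := boolP [forall i, #|fam S lab DD i| <= 1].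
  by left; apply: (clusters_knit cDD) => i; apply: (forallP f1).
rewrite negb_forall => /existsP[i]; rewrite -ltnNge => mi; right.
have [m3|m3] := leqP 3 #|fam S lab DD i|.
  have /card_gt2P[D1 [D2 [D3 [[F1 F2 F3] [n12 n23 n31]]]]] := m3.
  have [a1 [x1 [a1W x1D e1]]] := nbW _ _ F1; have [a2 [x2 [a2W x2D e2]]] := nbW _ _ F2.
  have [a3 [x3 [a3W x3D e3]]] := nbW _ _ F3; exfalso.
  apply: (balls a1 a2 a3) => //.
  - exact: (dist i D1 D2 a1 a2 x1 x2).
  - by apply: (dist i D1 D3 a1 a3 x1 x3); rewrite // eq_sym.
  - exact: (dist i D2 D3 a2 a3 x2 x3).
(* For the last two clusters the budget drops from 6 to 0, so even the connector [a x p q y b] is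
   affordable; hence no edge [pq] leaves [A] within [W]. *)
have m2 : #|fam S lab DD i| = 2 by apply/eqP; rewrite eqn_leq mi -ltnS m3.
have /card_gt1P[D1 [D2 [F1 F2 n12]]] := mi.
have [a [x1 [aW x1D e1]]] := nbW _ _ F1; have [b [x2 [bW x2D e2]]] := nbW _ _ F2.
have dab := dist _ _ _ _ _ _ _ F1 F2 n12 aW bW x1D x2D e1 e2.
pose A := [set p in W | ~~ [disjoint ball W p & ball W a]].
have mA p : p \in A -> exists x, [/\ p \in W, x \in ball W a & x \in ball W p].
  rewrite inE => /andP[pW]; rewrite -setI_eq0 => /set0Pn[x /setIP[h1 h2]].
  by exists x.
have mB p : p \in W :\: A -> exists x, [/\ p \in W, x \in ball W b & x \in ball W p].
  rewrite in_setD => /andP[+ pW]; rewrite inE pW /= negbK => dpa.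
  have : ~~ [disjoint ball W p & ball W b].
    apply/negP=> dpb; exact: (balls p a b).
  rewrite -setI_eq0 => /set0Pn[x /setIP[h1 h2]].
  by exists x.
have noedge p q : p \in A -> q \in W :\: A -> ~~ e p q.
  move=> pA qB; apply/negP=> epq.
  have [x [pW xa xp]] := mA _ pA; have [y [qW yb yq]] := mB _ qB.
  have [s1 c1] := cball _ _ aW xa; have [s2 c2] := cball _ _ pW xp.
  have [s3 c3] := cball _ _ bW yb; have [s4 c4] := cball _ _ qW yq.
  have c12 : conn e ([set a; x] :|: [set p; x]).
    by apply: (connU es c1 c2 (x := x) (y := x)); rewrite ?set22 ?eqxx.
  have c34 : conn e ([set q; y] :|: [set b; y]).
    by apply: (connU es c4 c3 (x := y) (y := y)); rewrite ?set22 ?eqxx.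
  pose Z := ([set a; x] :|: [set p; x]) :|: ([set q; y] :|: [set b; y]).
  have cZ : conn e Z.
    by apply: (connU es c12 c34 (x := p) (y := q)); rewrite ?epq ?orbT // !inE !eqxx ?orbT.
  have ZW : Z \subset W.
    by rewrite subUset; apply/andP; split; rewrite subUset ?s1 ?s2 ?s3 ?s4.
  have := join_two es cDD mDD F1 F2 n12 ZW cZ (a1 := a) (a2 := b) _ _ x1D x2D e1 e2.
  rewrite !inE !eqxx !orbT m2 => /(_ isT isT).
  have : #|Z| <= 6.
    have : Z \subset [set:: [:: a; x; p; q; y; b]].
      apply/subsetP=> z; rewrite !inE.
      by case: (z == a) (z == x) (z == p) (z == q) (z == y) (z == b) => [] [] [] [] [] [].
    move/subset_leq_card => h; apply: leq_trans h _; rewrite cardsE; exact: card_size.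
  by rewrite /w_half /=; clear; lia.
have aA : a \in A.
  by rewrite inE aW -setI_eq0; apply/set0Pn; exists a; rewrite inE ball_refl.
have bB : b \in W :\: A by rewrite in_setD bW andbT inE bW /= negbK disjoint_sym.
have AW : A \subset W by apply/subsetP=> p; rewrite inE => /andP[].
have WS : W \subset V :\: S by apply: setDS.
have cA : #|A| + #|W :\: A| = #|W| by rewrite -(cardsID A W) (setIidPr AW).
have finish B : B != set0 -> B \subset W -> 2 * #|B| <= #|W| ->
    (forall p q, p \in B -> q \in W :\: B -> ~~ e p q) ->
    [/\ B != set0, B \subset V :\: S, 2 * r <= #|S|, 2 * #|B| + #|S| + r <= 8 * l + 1 &
      forall p, p \in B -> 4 * l + 1 <= #|nb e B p| + #|S| + r].
  move=> B0 BW B2 nB; split=> //; first exact: subset_trans BW WS.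
    by move: B2 rU cW Vl; clear; lia.
  move=> p pB; have -> : nb e B p = nb e W p; last by apply: degW; apply: (subsetP BW).
  apply/setP=> q; rewrite [LHS]inE [RHS]inE; case qB: (q \in B) => /=.
    by rewrite (subsetP BW _ qB).
  case qW: (q \in W) => //=; apply/esym/negbTE/nB => //.
  by rewrite in_setD qB qW.
have [h|h] := leqP (2 * #|A|) #|W|.
  by exists A, r; apply: finish => //; apply/set0Pn; exists a.
exists (W :\: A), r; apply: finish.
- by apply/set0Pn; exists b.
- exact: subsetDl.
- by move: h cA; clear; lia.
move=> p q pB; rewrite !in_setD => /andP[+ qW]; rewrite qW andbT negbK => qA.
by rewrite es; apply: noedge.
Qed.

(* Up to four clusters are joined in pairs through one vertex, and from five
   clusters on some vertex joins three: at most 3/4 vertex per terminal. *)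
Definition w_dense m := if m <= 4 then m.-1 else (m + 2) %/ 2.

Lemma w_dense_pred m : 1 < m -> m <= 4 -> w_dense m = 1 + w_dense m.-1.
Proof. by rewrite /w_dense; do 2 case: ifP; lia. Qed.

Lemma w_dense_sub m k : 4 < m -> 2 < k -> 1 + w_dense (m.+1 - k) <= w_dense m.
Proof. by rewrite /w_dense; do 2 case: ifP; lia. Qed.

(** The clusters cover a set U of at most 7l/4 vertices. The first inequality gives two nonadjacent
    terminals a common neighbour outside U, as 2d - (|V| - 2) exceeds |U| - 2. The second gives five
    terminals in distinct clusters an outside vertex adjacent to three of them, as 5(d + 1 - |U|)
    exceeds 2(|V| - |U|). *)
Lemma dense_knittable V S l d : S \subset V -> #|S| <= l ->
    (forall h, h \in V -> d <= #|nb e V h|) ->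
    4 * #|V| + 7 * l < 4 * (2 * d + 4) -> 8 * #|V| + 21 * l < 4 * (5 * d + 5) ->
  knittable V e S.
Proof.
move=> SV Sl degV hd1 hd2 lab.
have [DD [cDD wDD mDD]] := min_clustering e lab w_dense SV.
have [tD SD DV pD] := clusteringP _ _ _ _ _ cDD.
pose W := V :\: cover DD.
have cU : 4 * #|cover DD| <= 7 * l.
  apply: leq_trans (cover_bound (c := 4) (d := 3) cDD wDD _) _.
    by move=> m; rewrite /w_dense; case: ifP => h; lia.
  by rewrite leq_mul2l Sl orbT.
have cW : #|W| + #|cover DD| = #|V|.
  by rewrite -(cardsID (cover DD) V) (setIidPr DV) addnC.
apply: (clusters_knit cDD) => i; rewrite leqNgt; apply/negP=> mi.
have term D : D \in fam S lab DD i -> exists2 s, s \in D & s \in cover DD.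
  move=> /(fam_fib cDD)[DDD _]; have [_ [j [/set0Pn[s /setIP[sD sS]] _]]] := pD _ DDD.
  by exists s => //; apply: (subsetP SD).
have [m4|m4] := leqP #|fam S lab DD i| 4.
  have /card_gt1P[D1 [D2 [F1 F2 n12]]] := mi.
  have [s sD sU] := term _ F1; have [t tD' tU] := term _ F2.
  have st : s != t.
    apply: contraNneq n12 => E; apply/eqP.
    apply: (trivIset_eq (x := s) tD) => //; last by rewrite E.
      by case: (fam_fib cDD F1).
    by case: (fam_fib cDD F2).
  have [est|nst] := boolP (e s t).
    have := join_adjacent es cDD mDD F1 F2 n12 sD tD' est.
    by rewrite (w_dense_pred mi m4); clear; lia.
  have sV := subsetP DV _ sU; have tV := subsetP DV _ tU.
  have [x /setIP[xs xt] xU] : exists2 x, x \in nb e V s :&: nb e V t & x \notin cover DD.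
    apply/exists_inP; apply: contraT => /exists_inPn h.
    have sub1 : nb e V s :&: nb e V t \subset cover DD :\: [set s; t].
      apply/subsetP=> x xI; have := h _ xI; rewrite negbK in_setD => -> ; rewrite andbT.
      move: xI; rewrite !inE negb_or => /andP[/andP[_ esx] /andP[_ etx]].
      by apply/andP; split; [apply: contraTneq esx => ->|apply: contraTneq etx => ->]; rewrite ei.
    have sub2 : nb e V s :|: nb e V t \subset V :\: [set s; t].
      apply/subsetP=> x; rewrite !inE negb_or => h'.
      have -> : x \in V by case/orP: h' => /andP[].
      rewrite andbT; case/orP: h' => /andP[_ ex]; apply/andP; split.
      - by apply: contraTneq ex => ->; rewrite ei.
      - by apply: contraTneq ex => ->.
      - by apply: contraTneq ex => ->; rewrite es.
      - by apply: contraTneq ex => ->; rewrite ei.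
    have := subset_leq_card sub1; have := subset_leq_card sub2; rewrite !cardsD.
    have -> : cover DD :&: [set s; t] = [set s; t] by apply/setIidPr; rewrite subUset !sub1set sU.
    have -> : V :&: [set s; t] = [set s; t] by apply/setIidPr; rewrite subUset !sub1set sV.
    have stU : 2 <= #|cover DD|.
      have : [set s; t] \subset cover DD by rewrite subUset !sub1set sU.
      by move/subset_leq_card; rewrite cards2 st.
    rewrite cards2 st; have := cardsUI (nb e V s) (nb e V t).
    have := degV _ sV; have := degV _ tV; have := subset_leq_card DV.
    move: cU hd1 stU; clear; rewrite /=; lia.
  have xW : x \in W by rewrite inE xU; move: xs; rewrite inE => /andP[].
  have xs' : e x s by move: xs; rewrite inE es => /andP[].
  have xt' : e x t by move: xt; rewrite inE es => /andP[].
  have := join_two es cDD mDD F1 F2 n12 (Z := [set x]) _ (conn1 e x) (set11 x) (set11 x) sD tD' xs' xt'.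
  rewrite sub1set cards1 => /(_ xW).
  by rewrite (w_dense_pred mi m4); clear; lia.
have [D0 F0] : exists D0, D0 \in fam S lab DD i by apply/card_gt0P; apply: ltnW.
have [s0 _ _] := term _ F0.
have ex D : exists s, D \in fam S lab DD i -> s \in D /\ s \in cover DD.
  have [/term[s h1 h2]|] := boolP (D \in fam S lab DD i); first by exists s.
  by exists s0.
have {ex} [s hs] := fin_all_exists ex.
pose J x := [set D in fam S lab DD i | e (s D) x].
have [x xW J3] : exists2 x, x \in W & 2 < #|J x|.
  apply/exists_inP; apply: contraT => /exists_inPn h.
  have up : \sum_(D in fam S lab DD i) #|nb e W (s D)| <= 2 * #|W|.
    have -> : \sum_(D in fam S lab DD i) #|nb e W (s D)| =
        \sum_(D in fam S lab DD i) \sum_(x in W) e (s D) x.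
      apply: eq_bigr => D _; rewrite -sum1_card big_mkcond [RHS]big_mkcond /=.
      apply: eq_bigr => x _; rewrite inE.
      by case: (x \in W) => //=; case: (e _ _).
    rewrite exchange_big mulnC -sum_nat_const; apply: leq_sum => x xW.
    have := h _ xW; rewrite -leqNgt; apply: leq_trans.
    rewrite -sum1_card [X in X <= _]big_mkcond [X in _ <= X]big_mkcond /=.
    by apply: leq_sum => D _; rewrite [D \in J x]inE; case: (D \in fam S lab DD i) => //=; case: (e _ _).
  have low : 5 * (d.+1 - #|cover DD|) <= \sum_(D in fam S lab DD i) #|nb e W (s D)|.
    apply: leq_trans (_ : #|fam S lab DD i| * (d.+1 - #|cover DD|) <= _).
      by rewrite leq_mul2r m4 orbT.
    rewrite -sum_nat_const; apply: leq_sum => D /hs[_ sU].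
    have := degV _ (subsetP DV _ sU); rewrite (card_nbD _ DV) -/W.
    have : nb e (cover DD) (s D) \subset cover DD :\ s D.
      apply/subsetP=> y; rewrite !inE => /andP[-> ey]; rewrite andbT.
      by apply: contraTneq ey => ->; rewrite ei.
    move/subset_leq_card; rewrite (cardsD1 (s D) (cover DD)) sU.
    by clear; lia.
  by have := leq_trans low up; move: cU cW hd2; clear; lia.
have JF : J x \subset fam S lab DD i by apply/subsetP=> D; rewrite inE => /andP[].
have := @join_clusters _ e V S lab w_dense DD cDD mDD i (J x) [set x] JF (ltnW J3).
rewrite sub1set xW cards1 => /(_ isT) H.
have : w_dense #|fam S lab DD i| < 1 + w_dense (#|fam S lab DD i|.+1 - #|J x|).
  apply: H; apply: (conn_from es (x := x)); first by rewrite !inE eqxx orbT.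
  move=> z; rewrite inE => /orP[/bigcupP[D DJ zD]|/set1P->//].
  have [DF esx] : D \in fam S lab DD i /\ e (s D) x by move: DJ; rewrite inE => /andP[].
  have [sD _] := hs _ DF; have [/connP[_ c] _] := pD _ (fam_fib cDD DF).1.
  have sub : D \subset cover (J x) :|: [set x].
    by apply: subset_trans (subsetUl _ _); apply: bigcup_sup.
  apply: (@connect_trans _ _ (s D)); last by apply: connect_restrS sub _ _ (c _ _ sD zD).
  by apply: connect1; rewrite /= es esx (subsetP sub _ sD) !inE eqxx orbT.
by have := w_dense_sub m4 J3; clear; lia.
Qed.
End Dense.

(** * Massed pairs are knitted *)

Section MassedKnitted.
Variable T : finType.
Implicit Types (e : rel T) (A B H S U V X : {set T}) (x y u v : T).

Lemma card_dep_pairs A (F : T -> {set T}) :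
  #|[set p : T * T | (p.1 \in A) && (p.2 \in F p.1)]| = \sum_(x in A) #|F x|.
Proof.
rewrite -sum1_card (eq_bigr (fun x => \sum_(y in F x) 1)); last first.
  by move=> x _; rewrite sum1_card.
by rewrite pair_big_dep /=; apply: eq_bigl => p; rewrite inE.
Qed.

(** The first summand counts pairs starting outside [X]; the second, after swapping, those starting
    in [X]. *)
Lemma sum_deg_pairs V e X : symmetric e -> X \subset V ->
  \sum_(v in V :\: X) (#|nb e V v| + #|nb e X v|) <= #|pairs V e (V :\: X)|.
Proof.
move=> es XV; rewrite big_split /= -!card_dep_pairs.
set P1 := [set p | _]; set P2 := [set p | _].
pose sw (p : T * T) := (p.2, p.1).
have swI : injective sw by move=> [a b] [c d] [-> ->].
rewrite -(card_imset P2 swI).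
have -> : #|P1| + #|sw @: P2| = #|P1 :|: sw @: P2|.
  rewrite cardsU [P1 :&: _](_ : _ = set0) ?cards0 ?subn0 //.
  apply/setP=> -[a b]; rewrite in_set0; apply/negP=> /setIP[].
  rewrite inE /= => /andP[/setDP[_ aX] _] /imsetP[[c d]]; rewrite inE /= => /andP[_ cd] [ad _].
  by move: cd; rewrite inE -ad (negPf aX).
apply/subset_leq_card/subsetP=> -[a b] /setUP[|/imsetP[[c d]]]; rewrite !inE /=.
  by case/andP=> /andP[-> ->] /andP[-> ->].
case/andP=> /andP[cX cV] /andP[dX ecd] [-> ->].
by rewrite cX cV (subsetP XV) // es ecd orbT.
Qed.

Lemma nb_neq0P e V a : reflect (exists2 y, y \in V & e a y) (nb e V a != set0).
Proof.
apply: (iffP (set0Pn _)) => [[y]|[y yV ay]]; first by rewrite inE => /andP[]; exists y.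
by exists y; rewrite inE yV.
Qed.

(** * The minimal counterexample *)

Section Minimal.
Variables (l : nat) (V : {set T}) (e : rel T) (X : {set T}).
Hypotheses (l0 : 0 < l) (es : symmetric e) (ei : irreflexive e) (Xl : #|X| <= l).
Hypotheses (ms : massed (4 * l) V e X) (IH : @IHmassed T (4 * l) l #|V|).
Hypothesis IHe : forall e', symmetric e' -> irreflexive e' -> subrel e' e ->
  #|edges V e'| < #|edges V e| -> massed (4 * l) V e' X -> knittable V e' X.
Hypothesis nk : ~ knittable V e X.

(* Deletes an edge with both ends outside X; an edge at X would not do, since
   deleting it may cut a terminal off. *)
Lemma few_pairs : #|pairs V e (V :\: X)| <= 2 * (4 * l) * #|V :\: X| + 2.
Proof.
have [XV M1 M2] := ms; rewrite leqNgt; apply/negP=> big.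
(* If every counted edge had an end in [X], there would be at most [2 * l * #|V :\: X|] pairs. *)
have [x [y [xY yY exy]]] : exists x y, [/\ x \in V :\: X, y \in V :\: X & e x y].
  have [/exists_inP[[x y] + /andP[/= xX yX]]|noe] :=
      boolP [exists p in pairs V e (V :\: X), (p.1 \notin X) && (p.2 \notin X)].
    rewrite !inE /= => /and4P[xV yV exy _]; exists x, y.
    by rewrite !inE xX yX xV yV.
  have : pairs V e (V :\: X) \subset setX X (V :\: X) :|: setX (V :\: X) X.
    apply/subsetP=> -[x y] pxy; have := exists_inPn noe _ pxy.
    move: pxy; rewrite !inE /= negb_and !negbK => /and4P[-> -> _].
    by case: (x \in X); case: (y \in X).
  move/subset_leq_card => h.
  have := leq_trans h (leq_of_leqif (leq_card_setU _ _)); rewrite !cardsX => h'.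
  have h2 : #|X| * #|V :\: X| <= l * #|V :\: X| by rewrite leq_mul2r Xl orbT.
  by move: big h' h2; rewrite (mulnC #|V :\: X| #|X|); clear; lia.
have [/setDP[xV xX] /setDP[yV yX]] := (xY, yY).
pose e' := del e x y.
have es' : symmetric e' := del_sym x y es.
have ee' : subrel e' e by move=> p q /andP[].
have ei' : irreflexive e' by move=> p; apply/negP=> /ee'; rewrite ei.
have sub Y : pairs V e' Y \subset pairs V e Y.
  by apply/subsetP=> p; rewrite !inE => /and4P[-> -> /ee'-> ->].
apply: nk; apply: (knittable_mono (subxx V) ee'); apply: IHe => //; first exact: del_edges.
split=> //.
  have : pairs V e (V :\: X) \subset pairs V e' (V :\: X) :|: [set (x, y); (y, x)].
    apply/subsetP=> -[p q]; rewrite inE /= => /and4P[pV qV epq pq].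
    rewrite in_setU in_set2 [_ \in pairs _ _ _]inE /= pV qV pq andbT /e' /= epq /=.
    have [/set2_mem[[-> ->]|[-> ->]]|_] := eqVneq [set p; q] [set x; y];
      by rewrite ?eqxx ?orbT.
  move/subset_leq_card => h.
  have := leq_trans h (leq_of_leqif (leq_card_setU _ _)); rewrite cards2.
  by move: big; clear; case: (_ != _) => /=; lia.
move=> A B s' XA o; rewrite leqNgt; apply/negP=> vio'.
have vio : 2 * (4 * l) * #|B :\: A| < #|pairs V e (B :\: A)|.
  exact: leq_trans vio' (subset_leq_card (sub _)).
have AB0 := order_proper XA o.
have [s|ns] := boolP (sep V e A B).
  by apply: nk; apply: (violation_knittable es ei Xl ms IH s XA (ltnW o) AB0 vio).
have [UV nC] := sepP _ _ _ _ s'.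
move: ns; rewrite /sep UV eqxx /= negb_forall_in => /exists_inP[p /setDP[pA pB]].
rewrite negb_forall_in => /exists_inP[q /setDP[qB qA]] /negPn epq.
have Epq : [set p; q] = [set x; y].
  by apply/eqP; move: (nC _ _ pA pB qB qA); rewrite /e' /= epq negbK.
have pX : p \notin X by case: (set2_mem Epq) => -[-> _].
(* Only the deleted edge crosses; adding its end [p] to [B] restores a separation at the cost of one
   in the order. *)
have s : sep V e A (p |: B).
  apply/sepP; split.
    by rewrite setUCA UV; apply/setUidPr; rewrite sub1set (subsetP (sep_sub_l s')).
  move=> a b aA; rewrite !inE negb_or => /andP[ap aB] /orP[/eqP->|bB] bA.
    by rewrite pA in bA.
  apply/negP=> eab; have := nC _ _ aA aB bB bA; rewrite /e' /= eab negbK -Epq => /eqP.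
  by case/set2_mem=> -[E1 E2]; [rewrite E1 eqxx in ap|rewrite E1 qB in aB].
have EI : A :&: (p |: B) = p |: (A :&: B).
  by apply/setP=> a; rewrite !inE; case: eqP => // ->; rewrite pA.
have ED : (p |: B) :\: A = B :\: A.
  by apply/setP=> a; rewrite !inE; case: eqP => // ->; rewrite pA.
apply: nk; apply: (violation_knittable es ei Xl ms IH s XA); rewrite ?ED //.
  by rewrite EI cardsU1 inE (negPf pB) andbF.
(* An empty near side would force [A] to equal [X] by cardinality, and so put [p] in [X]. *)
apply: contraNneq pX => AB.
have EX : X = A.
  apply/eqP; rewrite eqEcard XA -(cardsID (p |: B) A) AB cards0 addn0 EI cardsU1 inE (negPf pB) andbF.
  exact: o.
by rewrite EX.
Qed.

Lemma no_isolated v : v \in V -> v \notin X -> nb e V v != set0.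
Proof.
have [XV M1 M2] := ms.
move=> vV vX; apply/negP=> /eqP iso; have niso y : y \in V -> e v y = false.
  by move=> yV; have := in_set0 y; rewrite -iso inE yV.
have VV : V :\ v \subset V by apply: subsetDl.
have XV' : X \subset V :\ v by rewrite subsetD1 XV.
have cV : #|V| = (#|V :\ v|).+1 by rewrite (cardsD1 v V) vV.
apply: nk; apply: (knittable_mono VV (e := e)) => //; apply: IH => //; first by rewrite cV.
split=> //.
  apply: leq_trans (_ : #|pairs V e (V :\: X)| <= _).
    apply: leq_trans M1; rewrite ltnS leq_mul2l; apply/orP; right.
    by apply: subset_leq_card; apply: setSD.
  apply/subset_leq_card/subsetP=> -[x y]; rewrite !inE /= => /and4P[xV yV exy xyX].
  have xv : x != v by apply: contraTneq exy => ->; rewrite niso.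
  have yv : y != v by apply: contraTneq exy => ->; rewrite es niso.
  by rewrite xv yv xV yV exy /=; move: xyX; rewrite xV yV.
move=> A B s XA o; have [UV nC] := sepP _ _ _ _ s.
have vB : v \notin B by apply/negP=> /(subsetP (sep_sub_r s)); rewrite !inE eqxx.
have s2 : sep V e (v |: A) B.
  apply/sepP; split; first by rewrite -setUA UV setD1K.
  move=> x y; rewrite !inE negb_or => /orP[/eqP->|xA] xB yB /andP[yv yA]; last exact: nC.
  by rewrite niso //; apply: (subsetP VV); apply: (subsetP (sep_sub_r s)).
have EI : (v |: A) :&: B = A :&: B.
  by apply/setP=> x; rewrite !inE; case: eqP => // ->; rewrite (negPf vB) !andbF.
have ED : B :\: (v |: A) = B :\: A.
  by apply/setP=> x; rewrite !inE; case: eqP => // ->; rewrite (negPf vB) !andbF.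
have := M2 _ _ s2 (subset_trans XA (subsetUr _ _)); rewrite EI => /(_ o).
by rewrite (pairs_sep es s2) (pairs_sep es s) ED.
Qed.

Lemma low_degree : exists2 v, v \in V :\: X & #|nb e V v| + #|nb e X v| <= 8 * l.
Proof.
have [XV M1 M2] := ms; apply/exists_inP; apply: contraT => /exists_inPn h.
have h1 : (8 * l).+1 * #|V :\: X| <= #|pairs V e (V :\: X)|.
  apply: leq_trans (sum_deg_pairs es XV); rewrite mulnC -sum_nat_const.
  by apply: leq_sum => v /h; rewrite -ltnNge.
have h2 := few_pairs.
(* If all these sums exceed 8l, [few_pairs] leaves at most 2 vertices outside [X]; then the sum at
   any of them is at most 2l + 2, which is at most 8l. *)
have [Y0|[v vY]] := set_0Vmem (V :\: X).
  move: M1; rewrite Y0 [pairs _ _ _](_ : _ = set0) ?cards0 //.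
  by apply/setP=> p; rewrite !inE !andbF.
have := h _ vY; rewrite -ltnNge.
have : #|nb e V v| <= #|V| by apply/subset_leq_card/subsetP=> x; rewrite inE => /andP[].
have : #|nb e X v| <= #|X| by apply/subset_leq_card/subsetP=> x; rewrite inE => /andP[].
have := cardsD_sub XV; move: h1 h2 Xl l0; rewrite mulSn; clear; lia.
Qed.

Lemma minimal_false : False.
Proof.
have [XV M1 M2] := ms; have [v /setDP[vV vX] vdeg] := low_degree.
pose N := nb e V v; pose H := v |: N.
have NV : N \subset V by apply/subsetP=> x; rewrite inE => /andP[].
have HV : H \subset V by rewrite subUset sub1set vV.
have vN : v \notin N by rewrite inE ei andbF.
have cH : #|H| = #|N|.+1 by rewrite cardsU1 vN.
have NE u : u \in N -> u \in V /\ e v u by rewrite inE => /andP[].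
have tri u : u \in N -> 4 * l <= #|triangles V e X u v|.
  case/NE=> uV; rewrite es => euv.
  by case: (triangles_or_knittable es ei Xl ms IH uV vV vX euv) => // /nk.
have XH : X :&: H = nb e X v.
  apply/setP=> x; rewrite !inE; case xX: (x \in X) => //=.
  by rewrite (subsetP XV) //; case: eqP => // E; rewrite -E xX in vX.
have cHx : #|H| + #|X :&: H| <= 8 * l + 1 by rewrite XH cH; move: vdeg; rewrite -/N; clear; lia.
have [u0 u0V evu0] := nb_neq0P _ _ _ (no_isolated vV vX).
have u0N : u0 \in N by rewrite inE u0V.
have dN : 4 * l + 1 <= #|N|.
  rewrite (cardsD1 u0 N) u0N addnC leq_add2l; apply: leq_trans (tri _ u0N) _.
  by apply/subset_leq_card/subsetP=> y; rewrite !inE => /and4P[-> -> -> _].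
have degH h : h \in H -> h \notin X -> 4 * l + 1 <= #|nb e H h|.
  rewrite in_setU1 => /orP[/eqP->|hN] hX.
    apply: leq_trans dN _; apply/subset_leq_card/subsetP=> y yN.
    by rewrite inE in_setU1 yN orbT; case: (NE _ yN).
  have vT : v \notin triangles V e X h v by rewrite inE ei andbF.
  apply: leq_trans (_ : #|v |: triangles V e X h v| <= _).
    by rewrite cardsU1 vT addnC leq_add2l tri.
  apply/subset_leq_card/subsetP=> y; rewrite in_setU1 => /orP[/eqP->|].
    by rewrite inE in_setU1 eqxx es; case: (NE _ hN).
  by rewrite !inE (negPf hX) /= orbF => /and4P[-> -> _ ->]; rewrite orbT.
(* For [s] in [X], [triangles] may count members of [X :&: H] not adjacent to [s]. They lie in [S],
   hence occupy room in [U] anyway, and the rest of [U] cannot hold [v] and all the true neighbours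
   [M0]. *)
have degS S U s : X :&: H \subset S -> S \subset U -> U \subset H -> #|U| <= 4 * l ->
    s \in S -> exists2 a, a \in H :\: U & e s a.
  move=> XS SU UH Ul sS; have sH := subsetP UH _ (subsetP SU _ sS).
  suff [B [BU sB]] : exists B, ~~ (B \subset U) /\ B \subset nb e H s.
    case/subsetPn: BU => a aB aU; have := subsetP sB _ aB; rewrite inE => /andP[aH esa].
    by exists a; rewrite // inE aU.
  have [sX|sX] := boolP (s \in X); last first.
    exists (nb e H s); split=> //; apply/negP=> /subset_leq_card h.
    by have := degH _ sH sX; move: h Ul; clear; lia.
  have sN : s \in N.
    by move: sH; rewrite in_setU1 => /orP[/eqP E|//]; rewrite -E sX in vX.
  pose M0 := [set y in N :\: X | e s y].
  have vM : v \notin M0 by rewrite !inE ei !andbF.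
  have hM : 4 * l <= #|M0| + #|(X :&: H) :\ s|.
    apply: leq_trans (tri _ sN) _; apply: leq_trans _ (leq_of_leqif (leq_card_setU _ _)).
    apply/subset_leq_card/subsetP=> y; rewrite !inE sX /= => /and4P[-> -> -> h].
    by case yX: (y \in X) h => /=; rewrite ?orbF ?orbT // => ->.
  exists (v |: M0); split; last first.
    apply/subsetP=> y; rewrite in_setU1 => /orP[/eqP->|].
      by rewrite inE in_setU1 eqxx es; case: (NE _ sN).
    by rewrite inE in_setD => /andP[/andP[_ yN] sy]; rewrite inE in_setU1 yN orbT.
  apply/negP=> MU.
  have MUX : v |: M0 \subset U :\: X.
    rewrite subsetD MU disjoint_subset; apply/subsetP=> y; rewrite in_setU1 => /orP[/eqP->//|].
    by rewrite inE in_setD => /andP[/andP[yX _] _].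
  have := subset_leq_card MUX; rewrite cardsU1 vM.
  have := cardsID X U; have : #|X :&: H| <= #|U :&: X|.
    apply/subset_leq_card; rewrite subsetI (subset_trans XS SU) /=; exact: subsetIl.
  have := cardsD1 s (X :&: H); rewrite inE sX sH /=.
  by move: hM Ul; clear; lia.
(* The trivial separation [(V, B)] makes any large enough set [B] a target. *)
have tgt B : B \subset V -> #|X| <= #|B| ->
    (forall S, X :&: B \subset S -> S \subset B -> #|S| <= #|X| -> knittable B e S) -> False.
  move=> BV XB kB; apply: nk; have sVB : sep V e V B.
    by apply/sepP; split; [apply/setUidPl | move=> x y _ _ /(subsetP BV) ->].
  have E : V :&: B = B by apply/setIidPr.
  by apply: (target_knittable es ei Xl ms IH sVB XV); rewrite E.
apply: (tgt H HV); first by rewrite cH; move: dN Xl; clear; lia.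
move=> S XS SH SX lab.
have [||h hH hS|U s SU UH Ul sS|//|] := @half_or_knit T e es ei H S lab l SH.
- by apply: leq_trans cHx; apply: leq_addr.
- exact: leq_trans SX Xl.
- apply: degH => //; apply: contra hS => hX; apply: (subsetP XS); rewrite inE hX; exact: hH.
- exact: degS XS SU UH Ul sS.
(* One failing labelling in [H] yields [A]; the linkage to [H] is then discarded and [X] is linked
   afresh to [A]. *)
case=> A [r [A0 AHS r2 cA dA]]; exfalso.
have AH : A \subset H := subset_trans AHS (subsetDl _ _).
have Sl := leq_trans SX Xl.
have cA' : 4 * l + 2 <= #|A| + #|S| + r.
  have [a aA] := set0Pn _ A0; have := dA _ aA.
  have : nb e A a \subset A :\ a.
    apply/subsetP=> y; rewrite !inE => /andP[-> ay]; rewrite andbT.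
    by apply: contraTneq ay => ->; rewrite ei.
  by move/subset_leq_card; have := cardsD1 a A; rewrite aA /=; clear; lia.
apply: (tgt A (subset_trans AH HV)); first by move: cA' Sl r2 Xl; clear; lia.
move=> S' _ S'A S'X.
(* With t for [#|S| + r], at most 3l/2, the bound 2|A| <= 8l + 1 - t reduces the two inequalities to
   6t < 9l + 22 and 16t < 27l + 36. *)
apply: (dense_knittable es ei S'A (leq_trans S'X Xl) (d := 4 * l + 1 - #|S| - r)).
- by move=> h /dA; clear; lia.
- by move: cA Sl r2; clear; lia.
- by move: cA Sl r2; clear; lia.
Qed.
End Minimal.

Theorem massed_knittable l V e X : 0 < l -> symmetric e -> irreflexive e -> #|X| <= l ->
  massed (4 * l) V e X -> knittable V e X.
Proof.
move=> l0; have [n] := ubnP #|V|; elim: n V e X => // n IHn V e X Vn.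
have [m] := ubnP #|edges V e|; elim: m e => // m IHm e em es ei Xl ms.
have [//|nk] := knittable_dec V e X; exfalso.
apply: (minimal_false l0 es ei Xl ms _ _ nk).
  by move=> V' e' X' V'V es' ei' X'l ms'; apply: IHn => //; apply: leq_trans V'V _.
by move=> e' es' ei' _ ee ms'; apply: IHm => //; apply: leq_trans ee _.
Qed.
End MassedKnitted.

(** * From connectivity to massed pairs, and back to knitted graphs *)

Section HighConnectivity.
Variables (m : nat) (G : sgraph).
Hypothesis mG : k_connected m G.
Implicit Types (X A B : {set G}) (v : G).
Local Notation E := (@adj G).

Lemma k_connected_conn X : #|X| < m -> conn E (~: X).
Proof. by case: mG => _ H /H[h1 h2]; apply/connP. Qed.

Lemma k_connected_degree v : m <= #|nb E [set: G] v|.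
Proof.
rewrite leqNgt; apply/negP=> dv; have cN := k_connected_conn dv.
have vN : v \in ~: nb E [set: G] v by rewrite !inE adj_irr.
have [u uN] : exists u, u \in ~: nb E [set: G] v :\: [set v].
  apply/card_gt0P; rewrite cardsD (setIidPr _) ?sub1set // cards1 subn_gt0.
  by have := cardsC (nb E [set: G] v); case: mG; move: dv; clear; lia.
have [|x [y [/set1P-> /setDP[yN _] vy]]] := conn_cut cN (K := [set v]) _ (set11 v) uN.
  by rewrite sub1set.
by move: yN; rewrite !inE vy.
Qed.

Lemma k_connected_sep A B : sep [set: G] E A B -> #|A :&: B| < m ->
  A :\: B != set0 -> B :\: A = set0.
Proof.
move=> /sepP[UV nC] o /set0Pn[a /setDP[aA aB]]; apply/eqP; apply: contraT.
case/set0Pn=> b /setDP[bB bA].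
have KX : A :\: B \subset ~: (A :&: B).
  by apply/subsetP=> x; rewrite !inE => /andP[/negPf-> _]; rewrite andbF.
have aK : a \in A :\: B by rewrite inE aA aB.
have bK : b \in ~: (A :&: B) :\: (A :\: B).
  by rewrite !inE (negPf bA) bB.
have [x [y [/setDP[xA xB] yK exy]]] := conn_cut (k_connected_conn o) KX aK bK.
have yU : y \in A :|: B by rewrite UV inE.
move: yK yU; rewrite !inE => yK yU.
have yA : y \notin A by case: (y \in A) (y \in B) yK => [] [].
have yB : y \in B by rewrite (negPf yA) in yU.
by have := nC _ _ xA xB yB yA; rewrite exy.
Qed.
End HighConnectivity.

(** Degree 8l gives the density bound with equality allowed; strictness comes from a vertex [v]
    outside [X] adjacent to a terminal, whose edge to [X] is counted twice. Separations of order
    below l have an empty far side. *)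
Lemma k_connected_massed l (G : sgraph) (X : {set G}) : 0 < l ->
  k_connected (8 * l) G -> #|X| = l -> massed (4 * l) [set: G] adj X.
Proof.
move=> l0 cG Xl; have XV := subsetT X; split=> //; last first.
  move=> A B s XA o; have AB0 := order_proper XA o.
  have o' : #|A :&: B| < 8 * l by move: o; rewrite Xl; clear; lia.
  rewrite (k_connected_sep cG s o' AB0) (_ : pairs _ _ _ = set0) ?cards0 //.
  by apply/setP=> p; rewrite !inE !andbF.
apply: leq_trans (sum_deg_pairs (@adj_sym G) XV).
have [s sX] : exists s, s \in X by apply/card_gt0P; rewrite Xl.
have [v sv vX] : exists2 v, v \in nb adj [set: G] s & v \notin X.
  apply/subsetPn; apply/negP=> /subset_leq_card.
  by have := k_connected_degree cG s; rewrite Xl; move: l0; clear; lia.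
have vY : v \in [set: G] :\: X by rewrite !inE vX.
rewrite (bigD1 v) //= (cardsD1 v) vY mulnDr -addSn muln1; apply: leq_add.
  have : 0 < #|nb adj X v|.
    by apply/card_gt0P; exists s; rewrite inE sX adj_sym; move: sv; rewrite inE => /andP[].
  by have := k_connected_degree cG v; clear; lia.
rewrite mulnC -sum_nat_const (eq_bigl (fun x => (x \in [set: G] :\: X) && (x != v))); last first.
  by move=> x; rewrite in_setD1 andbC.
apply: leq_sum => x _; apply: leq_trans (leq_addr _ _).
by have := k_connected_degree cG x; clear; lia.
Qed.

Lemma connect_mono_eq (T : finType) V (e : rel T) g x y :
  connect (mono V e g) x y -> g x = g y.
Proof.
case/connectP=> p pp ->; elim: p x pp => //= z p IH x /andP[/and4P[_ _ _ /eqP->]].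
exact: IH.
Qed.

Lemma knittable_knitted (G : sgraph) (S : {set G}) : knittable [set: G] adj S -> knitted S.
Proof.
move=> kS P /and3P[/eqP cP tP P0].
(* Each part is labelled by one of its own elements, so a colour determines its part and different
   parts get disjoint components. *)
pose lab x := odflt x [pick y in pblock P x].
have labP B x : B \in P -> x \in B -> lab x \in B.
  move=> BP xB; rewrite /lab (def_pblock tP BP xB); by case: pickP.
have labE B x y : B \in P -> x \in B -> y \in B -> lab x = lab y.
  move=> BP xB yB; rewrite /lab (def_pblock tP BP xB) (def_pblock tP BP yB).
  by case: pickP => // /(_ x); rewrite xB.
have [g [gl gc]] := kS lab; pose r := mono [set: G] adj g.
have rs : symmetric r by move=> x y; rewrite /r /mono !inE adj_sym eq_sym.
have rr x y : connect (restr [set: G] r) x y = connect r x y.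
  by apply: eq_connect => a b; rewrite /= !inE.
pose C (B : {set G}) := if [pick s in B] is Some s then comp r [set: G] s else set0.
have CP B : B \in P -> exists2 s, s \in B & C B = comp r [set: G] s.
  move=> BP; rewrite /C; case: pickP => [s sB|B0]; first by exists s.
  by case/negP: P0; rewrite (_ : set0 = B) //; apply/setP=> x; rewrite inE B0.
have BS B x : B \in P -> x \in B -> x \in S.
  by move=> BP xB; rewrite -cP; apply/bigcupP; exists B.
have gC B s x : B \in P -> s \in B -> x \in C B -> g x = lab s.
  move=> BP sB; have [t tB ->] := CP _ BP; rewrite inE rr => /connect_mono_eq <-.
  by rewrite gl ?(BS B) //; apply: labE BP tB sB.
exists (fun B => induced (C B)); split.
- move=> B BP; have [s sB EC] := CP _ BP.
  have : conn adj (C B).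
    rewrite EC; apply: conn_sub_rel (comp_conn rs (in_setT s)).
    by move=> x y /and4P[].
  by case/connP.
- move=> B BP; apply/subsetP=> x xB /=; have [s sB ->] := CP _ BP.
  by rewrite inE rr; apply: gc; rewrite ?(BS B) //; apply: labE BP sB xB.
move=> B1 B2 P1 P2 n12 /=; rewrite disjoint_subset; apply/subsetP=> x x1.
rewrite inE; apply: contra n12 => x2.
have [s sB _] := CP _ P1; have [t tB _] := CP _ P2.
have h := labP _ _ P1 sB; have h' := labP _ _ P2 tB.
rewrite -(gC _ _ _ P1 sB x1) in h; rewrite -(gC _ _ _ P2 tB x2) in h'.
by rewrite -(def_pblock tP P1 h) (def_pblock tP P2 h').
Qed.

Theorem mainTheorem3 (l : nat) (l_gt0 : 0 < l) (G : sgraph) :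
  k_connected (8 * l) G -> l_knitted l G.
Proof.
move=> cG S Sl; apply: knittable_knitted.
apply: (massed_knittable l_gt0 (@adj_sym G) (@adj_irr G)); first by rewrite Sl.
exact: k_connected_massed.
Qed.
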